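(* Let $p$ be a prime and let $G$ be a finite Abelian group whose Sylow $p$-subgroup has order $p^n$ and exponent $p^a>1$. Then $$l_{rad}(\mathbb Z_pG)=p^{a-1}+(p^a-p^{a-1})(n-a).$$
   Context: $\mathbb Z_p$ is the ring of $p$-adic integers. For a $\mathbb Z_p$-order $\Lambda$ in $\mathbb Q_pG$, $J(\Lambda)$ is the Jacobson radical, and for a full lattice $L$ in $\mathbb Q_pG$, $\mathrm{Id}(L)=\{a\in\mathbb Q_pG: aL\subseteq L,\ La\subseteq L\}$. The radical idealizer chain of $\Lambda$ is $\Lambda_0:=\Lambda$, $\Lambda_{m+1}:=\mathrm{Id}(J(\Lambda_m))$; it is an ascending chain of orders that becomes stationary, and $l_{rad}(\Lambda)$ is the minimal $N$ with $\Lambda_N=\Lambda_{N+1}$. *)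

(* Defs.v *)
From HB Require Import structures.
From mathcomp Require Import all_boot all_order all_algebra all_fingroup.
From mathcomp Require Import boolp classical_sets.

Set Implicit Arguments.
Unset Strict Implicit.
Unset Printing Implicit Defensive.

Import Order.TTheory GRing.Theory Num.Theory.
Local Open Scope ring_scope.

(* The p-adic integers, as the inverse limit of the rings Z/p^k: an element is
   a compatible sequence, its k-th term being the representative in [0, p^k)
   of its class mod p^k (taking k := 0 forces the 0-th term to be 0).
   The primality proof is a parameter of the type so that the integral domain
   structure can be attached to it. *)

Record padic_int (p : nat) (p_pr : prime p) := PadicInt {
  padic_res :> nat -> int;
  padic_resP : forall k, (padic_res k.+1 %% (p ^ k)%N)%Z = padic_res k }.

Section PadicInt.
Variables (p : nat) (p_pr : prime p).
Local Notation Zp := (padic_int p_pr).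
Local Notation q k := (Posz (p ^ k)%N).

HB.instance Definition _ := gen_eqMixin Zp.
HB.instance Definition _ := gen_choiceMixin Zp.

Lemma padicP (x y : Zp) : (forall k, x k = y k) -> x = y.
Proof.
case: x y => [x xP] [y yP] /= /funext exy; rewrite exy in xP *.
by congr PadicInt; apply: Prop_irrelevance.
Qed.

Lemma modz_pS (m : int) k : ((m %% q k.+1)%Z %% q k)%Z = (m %% q k)%Z.
Proof.
by rewrite {2}(divz_eq m (q k.+1)) expnS PoszM mulrA modzMDl.
Qed.

Lemma padic_mod (x : Zp) k : (x k %% q k)%Z = x k.
Proof. by rewrite -(padic_resP x k) modz_mod. Qed.

Lemma padic_modS (x : Zp) k : (x k.+1 = x k %[mod q k])%Z.
Proof. by rewrite padic_resP padic_mod. Qed.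

Definition padic_of_int (m : int) : Zp.
Proof. by exists (fun k => m %% q k)%Z => k; exact: modz_pS. Defined.

Definition padic_opp (x : Zp) : Zp.
Proof.
exists (fun k => (- x k) %% q k)%Z => k.
by rewrite modz_pS -modzNm padic_modS modzNm.
Defined.

Definition padic_add (x y : Zp) : Zp.
Proof.
exists (fun k => (x k + y k) %% q k)%Z => k.
by rewrite modz_pS -modzDm !padic_modS modzDm.
Defined.

Definition padic_mul (x y : Zp) : Zp.
Proof.
exists (fun k => (x k * y k) %% q k)%Z => k.
by rewrite modz_pS -modzMm !padic_modS modzMm.
Defined.

Fact padic_addA : associative padic_add.
Proof.
by move=> x y z; apply: padicP => k /=; rewrite modzDml modzDmr addrA.
Qed.

Fact padic_addC : commutative padic_add.
Proof. by move=> x y; apply: padicP => k /=; rewrite addrC. Qed.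

Fact padic_add0 : left_id (padic_of_int 0) padic_add.
Proof.
by move=> x; apply: padicP => k /=; rewrite mod0z add0r padic_mod.
Qed.

Fact padic_addN : left_inverse (padic_of_int 0) padic_opp padic_add.
Proof. by move=> x; apply: padicP => k /=; rewrite modzDml addNr. Qed.

HB.instance Definition _ :=
  GRing.isZmodule.Build Zp padic_addA padic_addC padic_add0 padic_addN.

Fact padic_mulA : associative padic_mul.
Proof.
by move=> x y z; apply: padicP => k /=; rewrite modzMml modzMmr mulrA.
Qed.

Fact padic_mulC : commutative padic_mul.
Proof. by move=> x y; apply: padicP => k /=; rewrite mulrC. Qed.

Fact padic_mul1 : left_id (padic_of_int 1) padic_mul.
Proof. by move=> x; apply: padicP => k /=; rewrite modzMml mul1r padic_mod. Qed.

Fact padic_mulDl : left_distributive padic_mul padic_add.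
Proof.
by move=> x y z; apply: padicP => k /=; rewrite modzMml modzDm mulrDl.
Qed.

Fact padic_oner_neq0 : padic_of_int 1 != 0.
Proof.
apply/eqP => /(congr1 (fun x : Zp => x 1%N)) /=; rewrite mod0z expn1.
by rewrite modz_small // /= ltz_nat prime_gt1.
Qed.

HB.instance Definition _ := GRing.Zmodule_isComNzRing.Build Zp
  padic_mulA padic_mulC padic_mul1 padic_mulDl padic_oner_neq0.

Definition padic_unit (x : Zp) : bool := `[< exists y, y * x = 1 >].

Definition padic_inv (x : Zp) : Zp :=
  if pselect (exists y, y * x = 1) is left ex then projT1 (cid ex) else x.

Fact padic_mulV : {in padic_unit, left_inverse 1 padic_inv *%R}.
Proof.
by move=> x /asboolP ux; rewrite /padic_inv; case: pselect => // ex; case: cid.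
Qed.

Fact padic_unitPl (x y : Zp) : y * x = 1 -> padic_unit x.
Proof. by move=> yx1; apply/asboolP; exists y. Qed.

Fact padic_inv_out : {in [predC padic_unit], padic_inv =1 id}.
Proof.
by move=> x /asboolPn nux; rewrite /padic_inv; case: pselect.
Qed.

HB.instance Definition _ := GRing.ComNzRing_hasMulInverse.Build Zp
  padic_mulV padic_unitPl padic_inv_out.

Lemma padic_modD (x : Zp) k d : (x (k + d)%N %% q k)%Z = x k.
Proof.
elim: d => [|d IHd]; first by rewrite addn0 padic_mod.
rewrite addnS -IHd -(padic_resP x (k + d)) expnD PoszM.
set m := x _; rewrite [in LHS](divz_eq m (q k * q d)) mulrA mulrAC.
by rewrite modzMDl.
Qed.

Lemma padic_val (x : Zp) : x != 0 ->
  exists k, forall n, (k < n)%N -> (0 < `|x n|)%N /\ logn p `|x n| = k.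
Proof.
move=> nz_x; have ex : exists k, x k != 0.
  apply: contrapT => h; case/eqP: nz_x; apply: padicP => k /=.
  by rewrite mod0z; apply/eqP; apply: contrapT => /negP nz; apply: h; exists k.
case: (ex_minnP ex) => -[|k] nz_k min_k.
  by rewrite -(padic_mod x 0) expn0 modz1 in nz_k.
exists k => n lt_kn; have xk0 : x k = 0.
  by apply/eqP; apply: contraT => /min_k; rewrite ltnn.
have := padic_modD x k (n - k); rewrite subnKC ?(ltnW lt_kn) // xk0.
move/dvdz_mod0P; rewrite dvdzE /= => dvd_k.
have := padic_modD x k.+1 (n - k.+1); rewrite subnKC // => def_xk.
have ndvd : ~~ (p ^ k.+1 %| `|x n|)%N.
  apply: contra nz_k => d; rewrite -def_xk; apply/eqP/dvdz_mod0P.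
  by rewrite dvdzE.
have gt0 : (0 < `|x n|)%N by case: (posnP `|x n|) ndvd => // ->; rewrite dvdn0.
split=> //; apply/eqP; rewrite eqn_leq leqNgt.
by rewrite -!pfactor_dvdn // ndvd.
Qed.

Fact padic_integral (x y : Zp) : x * y = 0 -> (x == 0) || (y == 0).
Proof.
move=> xy0; apply/norP => -[/padic_val[k xP] /padic_val[l yP]].
set n := (k + l).+1.
have [|x0 xk] := xP n; first by rewrite ltnS leq_addr.
have [|y0 yl] := yP n; first by rewrite ltnS leq_addl.
have /= := congr1 (fun z : Zp => z n) xy0; rewrite mod0z.
move/dvdz_mod0P; rewrite dvdzE /= abszM pfactor_dvdn ?muln_gt0 ?x0 //.
by rewrite lognM // xk yl ltnn.
Qed.

HB.instance Definition _ :=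
  GRing.ComUnitRing_isIntegral.Build Zp padic_integral.

End PadicInt.

Notation padic_field p_pr := {fraction (padic_int p_pr)}.

(* The group algebra R[gT]: a formal sum of group elements is given by its
   coefficient function, and the product is the convolution.  The alias keeps
   it apart from the pointwise ring structure of {ffun gT -> R}. *)

Definition group_alg (R : Type) (gT : finGroupType) := {ffun gT -> R}.

Section GroupAlgebra.
Variables (R : comNzRingType) (gT : finGroupType).
Local Notation A := (group_alg R gT).
Implicit Types (f g h : A) (x y z : gT).

HB.instance Definition _ := GRing.Lmodule.copy A {ffun gT -> R^o}.

Definition group_alg_one : A := [ffun x => (x == 1%g)%:R].

Definition group_alg_mul f g : A :=
  [ffun x => \sum_(y : gT) f y * g (y^-1 * x)%g].

Fact group_alg_mulA : associative group_alg_mul.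
Proof.
move=> f g h; apply/ffunP => x; rewrite !ffunE.
under eq_bigr do rewrite ffunE mulr_sumr.
under [RHS]eq_bigr do rewrite ffunE mulr_suml.
rewrite [RHS]exchange_big /=; apply: eq_bigr => y _.
rewrite [RHS](reindex_inj (mulgI y)) /=; apply: eq_bigr => z _.
by rewrite mulKg invMg -mulgA mulrA.
Qed.

Fact group_alg_mul1l : left_id group_alg_one group_alg_mul.
Proof.
move=> f; apply/ffunP => x; rewrite ffunE (bigD1 1%g) //= big1 => [|y ny].
  by rewrite ffunE eqxx mul1r invg1 mul1g addr0.
by rewrite ffunE (negPf ny) mul0r.
Qed.

Fact group_alg_mul1r : right_id group_alg_one group_alg_mul.
Proof.
move=> f; apply/ffunP => x; rewrite ffunE (bigD1 x) //= big1 => [|y ny].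
  by rewrite ffunE mulVg eqxx mulr1 addr0.
by rewrite ffunE -eq_mulVg1 (negPf ny) mulr0.
Qed.

Fact group_alg_mulDl : left_distributive group_alg_mul +%R.
Proof.
move=> f g h; apply/ffunP => x; rewrite !ffunE -big_split /=.
by apply: eq_bigr => y _; rewrite ffunE mulrDl.
Qed.

Fact group_alg_mulDr : right_distributive group_alg_mul +%R.
Proof.
move=> f g h; apply/ffunP => x; rewrite !ffunE -big_split /=.
by apply: eq_bigr => y _; rewrite ffunE mulrDr.
Qed.

Fact group_alg_oner_neq0 : group_alg_one != 0.
Proof.
by apply/eqP => /ffunP/(_ 1%g)/eqP; rewrite !ffunE eqxx oner_eq0.
Qed.

HB.instance Definition _ := GRing.Zmodule_isNzRing.Build A
  group_alg_mulA group_alg_mul1l group_alg_mul1r group_alg_mulDl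
  group_alg_mulDr group_alg_oner_neq0.

Fact group_alg_scaleAl (a : R) f g : a *: (f * g) = (a *: f) * g.
Proof.
apply/ffunP => x; rewrite !ffunE [LHS]mulr_sumr.
by apply: eq_bigr => y _; rewrite ffunE mulrA.
Qed.

HB.instance Definition _ := GRing.Lmodule_isLalgebra.Build R A
  group_alg_scaleAl.

Fact group_alg_scaleAr (a : R) f g : a *: (f * g) = f * (a *: g).
Proof.
apply/ffunP => x; rewrite !ffunE [LHS]mulr_sumr.
by apply: eq_bigr => y _; rewrite ffunE mulrCA.
Qed.

HB.instance Definition _ := GRing.Lalgebra_isAlgebra.Build R A
  group_alg_scaleAr.

End GroupAlgebra.

Local Open Scope classical_set_scope.

Definition padic_group_ring (p : nat) (p_pr : prime p) (gT : finGroupType) :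
    set (group_alg (padic_field p_pr) gT) :=
  [set f : group_alg (padic_field p_pr) gT |
    forall x, exists z : padic_int p_pr, f x = FracField.tofrac z].
Arguments padic_group_ring {p} p_pr gT _.

(* Subrings, ideals and lattices of a fixed ambient ring A are given by their
   sets of elements. *)

Section RadicalIdealizer.
Variable A : nzRingType.
Implicit Types L M N Lambda : set A.

Definition left_ideal Lambda M : Prop :=
  [/\ M `<=` Lambda, M 0, (forall x y, M x -> M y -> M (x - y))
    & forall a x, Lambda a -> M x -> M (a * x)].

Definition maximal_left_ideal Lambda M : Prop :=
  [/\ left_ideal Lambda M, M <> Lambda
    & forall N, left_ideal Lambda N -> M `<=` N -> N = M \/ N = Lambda].

Definition jacobson_radical Lambda : set A :=
  [set x | Lambda x /\ forall M, maximal_left_ideal Lambda M -> M x].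

Definition idealizer L : set A :=
  [set a | (forall x, L x -> L (a * x)) /\ (forall x, L x -> L (x * a))].

Definition radical_idealizer_chain Lambda (m : nat) : set A :=
  iter m (fun L => idealizer (jacobson_radical L)) Lambda.

(* The relation "l_rad Lambda = N"; it entails that the chain does become
   stationary. *)
Definition is_lrad Lambda (N : nat) : Prop :=
  let chain := radical_idealizer_chain Lambda in
  chain N = chain N.+1 /\
  forall m, chain m = chain m.+1 -> (N <= m)%N.

End RadicalIdealizer.

(* Main.v *)
Require Import Defs.
From HB Require Import structures.
From mathcomp Require Import all_boot all_order all_algebra all_fingroup.
From mathcomp Require Import all_solvable.
From mathcomp Require Import boolp classical_sets.
From mathcomp Require Import ring zify.

Set Implicit Arguments.
Unset Strict Implicit.
Unset Printing Implicit Defensive.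

(* Let A = Q_p G.  Choose idempotents eps of A with sum 1, and for each of them
   t in Z_p G whose image generates the radical of the (semilocal) maximal
   order of A eps.  With M the maximal order and J its radical, every order R
   between Z_p G and M satisfies J(R) = R /\ J, because z^q - z is in J for
   all z in M and a suitable power q of p.  Hence
   - if J^c is contained in Z_p G, then J^(c-m) is contained in the m-th member
     of the chain, which therefore reaches M after at most c steps;
   - if t0 in Z_p G lies in J and eps0 lies in the m-th member, then t0^m eps0
     lies in Z_p G, so that t0^(c-1) eps0 not in Z_p G forces at least c steps.
   For a primitive idempotent eps of Q_p P whose kernel U has cyclic quotient
   P/U = <g U> of order p^i, i > 0, one has eps = e_U (1 - s/p), where e_U is
   the average over U and s is the sum of the powers of h = g^(p^(i-1)), and
   t = g - 1.  Modulo p, the identities t^(p^i - p^(i-1)) = s and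
   t^(p^(i-1)) = h - 1 together with s eps = 0 show that t^f eps is integral
   for f = p^(i-1) + (p^i - p^(i-1)) (n - i), which is largest for i = a; they
   also show that t^(f-1) eps is not integral when U is a complement of a
   cyclic subgroup <g> of order p^a. *)

(** * Subrings and their Jacobson radicals *)

Section Subring.
Import GRing.Theory.
Local Open Scope ring_scope.
Local Open Scope classical_set_scope.
Variable A : comNzRingType.
Implicit Types R I M : set A.

Record is_subring R : Prop := IsSubring {
  subring1 : R 1;
  subringB : forall x y, R x -> R y -> R (x - y);
  subringM : forall x y, R x -> R y -> R (x * y) }.

Section Closure.
Variables (R : set A) (rR : is_subring R).

Lemma subring0 : R 0.
Proof. by rewrite -(subrr 1); apply: (subringB rR); apply: (subring1 rR). Qed.

Lemma subringN x : R x -> R (- x).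
Proof. by rewrite -sub0r; apply: (subringB rR); apply: subring0. Qed.

Lemma subringD x y : R x -> R y -> R (x + y).
Proof. by move=> Rx /subringN; rewrite -{2}(opprK y); apply: (subringB rR). Qed.

Lemma subringX x k : R x -> R (x ^+ k).
Proof.
move=> Rx; elim: k => [|k IHk]; first exact: (subring1 rR).
by rewrite exprS; apply: (subringM rR).
Qed.

Lemma subring_nat k : R k%:R.
Proof.
elim: k => [|k IHk]; first exact: subring0.
by rewrite -natr1; apply: subringD => //; apply: (subring1 rR).
Qed.

Lemma subring_sum (J : Type) (r : seq J) (Q : pred J) (F : J -> A) :
  (forall j, Q j -> R (F j)) -> R (\sum_(j <- r | Q j) F j).
Proof. by move=> RF; apply: big_ind => //; [apply: subring0|apply: subringD]. Qed.

Lemma subring_horner (f : {poly int}) x :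
  R x -> R (map_poly intr f).[x].
Proof.
move=> Rx; rewrite horner_coef; apply: subring_sum => i _.
apply: (subringM rR); last exact: subringX.
rewrite coef_map /=; case: (f`_i) => k; first exact: subring_nat.
by rewrite NegzE mulrNz; apply: subringN; apply: subring_nat.
Qed.

(** Zorn's lemma on the ideals that contain [I] and avoid 1. *)
Lemma left_ideal_maximal I : left_ideal R I -> ~ I 1 ->
  exists2 M, maximal_left_ideal R M & I `<=` M.
Proof.
move=> idI I1.
pose Q (X : set A) := X = set0 \/ [/\ left_ideal R X, ~ X 1 & I `<=` X].
have [F FQ totF|X [QX maxX]] := @Zorn_bigcup A Q.
  have [[X0 FX0 neX0]|allF0] := pselect (exists2 X, F X & X <> set0); last first.
    left; apply/seteqP; split=> // x [X FX Xx]; case: allF0; exists X => // X0.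
    by rewrite X0 in Xx.
  have idF X x : F X -> X x -> [/\ left_ideal R X, ~ X 1 & I `<=` X].
    by move=> /FQ[->|].
  have [_ _ IX0] : [/\ left_ideal R X0, ~ X0 1 & I `<=` X0].
    by have [|] := FQ _ FX0.
  right; split; first split.
  - by move=> x [X FX Xx]; have [[sXR _ _ _] _ _] := idF _ _ FX Xx; apply: sXR.
  - by case: idI => _ I0 _ _; exists X0 => //; apply: IX0.
  - move=> x y [X FX Xx] [Y FY Yy].
    have [[_ _ BX _] _ _] := idF _ _ FX Xx.
    have [[_ _ BY _] _ _] := idF _ _ FY Yy.
    have [sXY|sYX] := totF _ _ FX FY.
      by exists Y => //; apply: BY => //; apply: sXY.
    by exists X => //; apply: BX => //; apply: sYX.
  - move=> a x Ra [X FX Xx]; exists X => //.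
    by have [[_ _ _ +] _ _] := idF _ _ FX Xx; apply.
  - by case=> X FX X1; have [] := idF _ _ FX X1.
  by move=> x Ix; exists X0 => //; apply: IX0.
have QI : Q I by right; split.
have [idX X1 IX] : [/\ left_ideal R X, ~ X 1 & I `<=` X].
  case: QX => // X0; case: (maxX I) => //; split; rewrite X0 // => I0.
  by case: idI => _ Iz _ _; have := I0 _ Iz.
exists X => //; split=> // [XR|N idN sXN].
  by apply: X1; rewrite XR; apply: (subring1 rR).
have [N1|N1] := pselect (N 1).
  right; apply/seteqP; split=> x; first by case: idN => sNR _ _ _; apply: sNR.
  by case: idN => _ _ _ MN Rx; rewrite -(mulr1 x); apply: MN.
left; apply: contrapT => neNX; apply: (maxX N).
  by split=> // sNX; apply: neNX; apply/seteqP.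
by right; split=> // x /IX/sXN.
Qed.

(** If [1 - y * x] has no inverse, a maximal ideal containing it also contains [x], hence 1.
    Conversely, if a maximal [M] misses [x], then [M + R x = R] puts some [1 - y * x], which is
    invertible, into [M]. *)
Lemma jacobson_radicalP x : jacobson_radical R x <->
  R x /\ forall y, R y -> exists2 z, R z & (1 - y * x) * z = 1.
Proof.
split=> [[Rx Jx]|[Rx invx]]; split=> //;
  [move=> y Ry | move=> M [[sMR M0 MB MM] neMR maxM]].
  have Ru : R (1 - y * x).
    by apply: (subringB rR); [apply: (subring1 rR)|apply: (subringM rR)].
  pose I := [set v | exists2 z, R z & (1 - y * x) * z = v].
  have idI : left_ideal R I.
    split=> [_ [z Rz <-]||_ _ [v Rv <-] [w Rw <-]|a _ Ra [z Rz <-]].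
    - exact: (subringM rR).
    - by exists 0; rewrite ?mulr0 //; apply: subring0.
    - by exists (v - w); rewrite ?mulrBr //; apply: (subringB rR).
    by exists (a * z); [apply: (subringM rR)|rewrite mulrCA].
  apply: contrapT => I1.
  have [M maxM sIM] := left_ideal_maximal idI I1.
  have [idM neMR _] := maxM; have [sMR M0 MB MM] := idM.
  apply: neMR; apply/seteqP; split=> // z Rz.
  rewrite -(mulr1 z); apply: (MM) => //.
  have -> : 1 = (1 - y * x) - (- y) * x :> A by rewrite mulNr opprK subrK.
  apply: MB.
    by apply: sIM; exists 1; rewrite ?mulr1 //; apply: (subring1 rR).
  apply: MM; first exact: subringN.
  exact: Jx.
apply: contrapT => nMx.
pose N := [set v | exists m y, [/\ M m, R y & v = m + y * x]].
have idN : left_ideal R N.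
  split=> [_ [m [y [Mm Ry ->]]]||_ _ [m [y [Mm Ry ->]]] [m' [y' [Mm' Ry' ->]]]
          |b _ Rb [m [y [Mm Ry ->]]]].
  - by apply: subringD; [apply: sMR|apply: (subringM rR)].
  - by exists 0, 0; split; rewrite ?mul0r ?addr0 //; apply: subring0.
  - exists (m - m'), (y - y'); split; [exact: MB|exact: (subringB rR)|ring].
  - exists (b * m), (b * y); split; [exact: MM|exact: (subringM rR)|ring].
have sMN : M `<=` N.
  by move=> m Mm; exists m, 0; rewrite mul0r addr0; split=> //; apply: subring0.
have [NM|NR] := maxM _ idN sMN.
  apply: nMx; rewrite -NM; exists 0, 1; rewrite mul1r add0r.
  by split=> //; apply: (subring1 rR).
have [m [y [Mm Ry def1]]] : N 1 by rewrite NR; apply: (subring1 rR).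
have [z Rz def_z] := invx y Ry.
apply: neMR; apply/seteqP; split=> // w Rw; rewrite -(mulr1 w); apply: (MM) => //.
have def_m : 1 - y * x = m by rewrite def1; ring.
by rewrite -def_z def_m mulrC; apply: MM.
Qed.

End Closure.
End Subring.

(** * The chain between an order and the maximal order *)

Section RadicalIdealizerChain.
Import GRing.Theory.
Local Open Scope ring_scope.
Local Open Scope classical_set_scope.
Variables (A : comNzRingType) (Lam : set A) (rLam : is_subring Lam).
Variables (p q n e c : nat) (K : finType) (eps t : K -> A) (eps0 t0 : A).
Hypothesis p_reg : forall x : A, p%:R * x = 0 -> x = 0.
Hypothesis Lam_inv : forall b, Lam b ->
  exists2 b', Lam b' & (1 - p%:R * b) * b' = 1.
Hypothesis q_gt1 : (1 < q)%N.
Hypothesis frobenius : forall k z, Lam z ->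
  exists2 b, Lam b & (z ^+ q - z) * eps k = t k * b * eps k.
Hypothesis eps_sum : \sum_k eps k = 1.
Hypothesis Lam_t : forall k, Lam (t k).
Hypothesis t_dvd_p : forall k,
  exists2 b, Lam b & p%:R * eps k = t k * b * eps k.
Hypothesis Lam_pX_eps : forall k, Lam (p%:R ^+ n * eps k).
Hypothesis p_dvd_tX : forall k, exists2 b, Lam b & t k ^+ e = p%:R * b.
Hypothesis Lam_tX_eps : forall k, Lam (t k ^+ c * eps k).
Hypothesis c_gt0 : (0 < c)%N.
Hypothesis Lam_t0 : Lam t0.
Hypothesis t_dvd_t0 : forall k,
  exists2 b, Lam b & t0 * eps k = t k * b * eps k.
Hypothesis eps0_max : forall k, exists2 b, Lam b & eps0 * eps k = b * eps k.
Hypothesis nLam_tX_eps0 : ~ Lam (t0 ^+ c.-1 * eps0).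

(* [npow 0] is the maximal order and [npow m] the [m]-th power of its
   Jacobson radical. *)
Definition npow (m : nat) : set A :=
  [set x | forall k, exists2 b, Lam b & x * eps k = t k ^+ m * b * eps k].

Let L1 := subring1 rLam.
Let LM := subringM rLam.
Let LB := subringB rLam.

Lemma npowM i j x y : npow i x -> npow j y -> npow (i + j) (x * y).
Proof.
move=> Nx Ny k; have [b Lb def_x] := Nx k; have [d Ld def_y] := Ny k.
exists (b * d); first exact: LM.
by rewrite -mulrA def_y mulrCA def_x exprD; ring.
Qed.

Lemma npowB i x y : npow i x -> npow i y -> npow i (x - y).
Proof.
move=> Nx Ny k; have [b Lb def_x] := Nx k; have [d Ld def_y] := Ny k.
by exists (b - d); [apply: LB|rewrite mulrBl def_x def_y; ring].
Qed.

Lemma npow_le i j x : (j <= i)%N -> npow i x -> npow j x.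
Proof.
move=> le_ji Nx k; have [b Lb def_x] := Nx k.
exists (t k ^+ (i - j) * b); first by apply: LM => //; apply: subringX.
by rewrite def_x -{1}(subnKC le_ji) exprD; ring.
Qed.

Lemma npow0_Lam x : Lam x -> npow 0 x.
Proof. by move=> Lx k; exists x; rewrite ?mul1r. Qed.

Lemma npow_exp i m x : npow i x -> npow (i * m) (x ^+ m).
Proof.
move=> Nx; elim: m => [|m IHm]; first by rewrite muln0; apply: npow0_Lam.
by rewrite exprS mulnS; apply: npowM.
Qed.

(** Each component of [x] is a multiple of [t k ^+ c * eps k], which lies in [Lam]. *)
Lemma npow_c_Lam x : npow c x -> Lam x.
Proof.
move=> Nx; rewrite -(mulr1 x) -eps_sum mulr_sumr; apply: subring_sum => // k _.
have [b Lb ->] := Nx k; rewrite mulrAC; exact: LM.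
Qed.

(** The power [n.+1 * e] of [t k] supplies [n.+1] factors [p]: [n] of them make [eps k] integral and
    one remains. *)
Lemma npow_pLam x : npow (n.+1 * e) x -> exists2 b, Lam b & x = p%:R * b.
Proof.
move=> Nx; suff: forall k, exists2 b, Lam b & x * eps k = p%:R * b.
  move=> def_x; rewrite -(mulr1 x) -[X in x * X]eps_sum mulr_sumr.
  apply: (big_ind (fun y => exists2 b, Lam b & y = p%:R * b)).
    by exists 0; rewrite ?mulr0 //; apply: subring0.
    move=> _ _ [b Lb ->] [d Ld ->]; exists (b + d); last by rewrite mulrDr.
    exact: subringD.
  by move=> k _; apply: def_x.
move=> k; have [b Lb ->] := Nx k; have [d Ld tE] := p_dvd_tX k.
exists (d ^+ n.+1 * b * (p%:R ^+ n * eps k)).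
  by apply: LM => //; apply: LM => //; apply: subringX.
by rewrite mulnC exprM tE exprMn [p%:R ^+ n.+1]exprS; ring.
Qed.

Lemma npow1_p : npow 1 p%:R.
Proof. exact: t_dvd_p. Qed.

Lemma mul_eps_exp k x b i :
  x * eps k = b * eps k -> x ^+ i * eps k = b ^+ i * eps k.
Proof.
move=> def_x; elim: i => [|i IHi]; first by rewrite !expr0.
by rewrite exprS -mulrA IHi mulrCA def_x exprS; ring.
Qed.

Lemma npow_frobenius x : npow 0 x -> npow 1 (x ^+ q - x).
Proof.
move=> Nx k; have [b Lb] := Nx k; rewrite mul1r => def_x.
by rewrite mulrBl (mul_eps_exp _ def_x) def_x -mulrBl; apply: frobenius.
Qed.

Lemma frobenius_iter k z j : Lam z ->
  exists2 b, Lam b & (z ^+ (q ^ j) - z) * eps k = t k * b * eps k.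
Proof.
move=> Lz; elim: j => [|j [b Lb IHj]].
  by exists 0; [apply: subring0|rewrite expr1 subrr mulr0 !mul0r].
have [d Ld def_d] := frobenius k (subringX rLam (q ^ j) Lz).
exists (d + b); first exact: subringD.
rewrite expnSr exprM -(subrK (z ^+ (q ^ j)) (_ ^+ q)) -addrA mulrDl def_d IHj.
ring.
Qed.

(* If [t^(r+1) x] lies in [Lam eps_k], it is nilpotent modulo [t], hence
   divisible by [t]. *)
Lemma npow0_integral x :
  (forall j, npow 0 (p%:R * x ^+ j)) -> npow 0 x.
Proof.
move=> Npx k; rewrite expr0.
(* Descent on [r] from [r = e], where [t k ^+ e] provides the factor [p] that makes [x] integral. *)
suff: forall r, (exists2 b, Lam b & t k ^+ r * x * eps k = b * eps k) ->
    exists2 b, Lam b & x * eps k = b * eps k.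
  move=> /(_ e)[|b Lb ->]; last by exists b; rewrite ?mul1r.
  have [b Lb ->] := p_dvd_tX k; have [d Ld] := Npx 1%N k.
  rewrite !expr1 mul1r => def_d; exists (b * d); first exact: LM.
  transitivity (b * (p%:R * x * eps k)); first ring.
  by rewrite def_d mulrA.
elim=> [|r IHr [b Lb def_b]]; first by rewrite mul1r.
apply: IHr.
(* Since [q ^ e] exceeds [e], the power of [t k] contains [t k ^+ e.+1]: a factor [t k], and a
   factor [p] that makes [x ^+ (q ^ e)] integral. *)
have [d Ld def_d] : exists2 d, Lam d & b ^+ (q ^ e) * eps k = t k * d * eps k.
  rewrite -(mul_eps_exp _ def_b) exprMn -exprM.
  have lt_e : (e.+1 <= r.+1 * q ^ e)%N.
    by apply: (leq_trans (ltn_expl e q_gt1)); rewrite leq_pmull.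
  rewrite -(subnKC lt_e) exprD exprS; have [d Ld ->] := p_dvd_tX k.
  have [f Lf] := Npx (q ^ e)%N k; rewrite mul1r => def_f.
  exists (d * t k ^+ (r.+1 * q ^ e - e.+1) * f).
    by do !apply: LM => //; apply: subringX.
  transitivity (t k * d * t k ^+ (r.+1 * q ^ e - e.+1) *
    (p%:R * x ^+ (q ^ e) * eps k)); first ring.
  by rewrite def_f; ring.
have [f Lf def_f] := frobenius_iter k e Lb.
exists (d - f); first exact: LB.
(* To cancel [t k] on this component, multiply by the [g] that turns it into [p], which is
   regular. *)
apply/eqP; rewrite -subr_eq0 -mulrBl; apply/eqP; apply: p_reg.
have [g Lg def_g] := t_dvd_p k.
transitivity (p%:R * eps k * (t k ^+ r * x - (d - f))); first by ring.
rewrite def_g.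
transitivity (g * (t k ^+ r.+1 * x * eps k
  - (t k * d * eps k - t k * f * eps k))); first by rewrite exprS; ring.
by rewrite def_b -def_d -def_f; ring.
Qed.

(** * Orders between [Lam] and the maximal order *)

Section Overorder.
Variables (R : set A) (rR : is_subring R).
Hypothesis sLamR : Lam `<=` R.
Hypothesis sRM : R `<=` npow 0.

(** For [x] in the radical, [1 - x ^+ q.-1] has an inverse [z] in [R], so [x = (x - x ^+ q) * z]
    lies in [npow 1]. Conversely, a high power of [y * x] lies in [p Lam], and a geometric sum
    reduces the inversion of [1 - y * x] to that of some [1 - p * b]. *)
Lemma jacobson_radical_npow x : jacobson_radical R x <-> R x /\ npow 1 x.
Proof.
rewrite jacobson_radicalP //; split=> -[Rx Jx]; split=> //; last first.
  move=> y Ry; set z := y * x.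
  have Nz : npow 1 z by apply: (npowM (sRM Ry) Jx).
  have := npow_exp (n.+1 * e) Nz; rewrite mul1n => /npow_pLam[b Lb def_b].
  have [d Ld def_d] := Lam_inv Lb.
  exists ((\sum_(i < n.+1 * e) z ^+ i) * d).
    apply: (subringM rR); last exact: sLamR.
    by apply: subring_sum => // i _; apply: subringX => //; apply: (subringM rR).
  rewrite mulrA -[X in X * _]opprK -mulNr opprB -subrX1 def_b opprB.
  exact: def_d.
have [z Rz def_z] := Jx (x ^+ q.-2) (subringX rR _ Rx).
suff -> : x = (x ^+ q - x) * (- z).
  apply: (npowM (npow_frobenius (sRM Rx))).
  by apply: sRM; apply: subringN.
have -> : x ^+ q = x ^+ q.-2 * x * x.
  by rewrite -!exprSr; case: (q) q_gt1 => [|[]].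
by rewrite -[LHS]mulr1 -def_z; ring.
Qed.

Let J := jacobson_radical R.

(** For the upper bound: [p] lies in [J], so any [x] in the idealizer has all [p * x ^+ j] in [J],
    and [npow0_integral] applies. *)
Lemma idealizer_overorder :
  [/\ is_subring (idealizer J), R `<=` idealizer J & idealizer J `<=` npow 0].
Proof.
have idE a : idealizer J a <-> forall x, J x -> J (a * x).
  split=> [[]//|Ja]; split=> // x Jx; rewrite mulrC; exact: Ja.
have JB x y : J x -> J y -> J (x - y).
  move=> /jacobson_radical_npow[Rx Nx] /jacobson_radical_npow[Ry Ny].
  by apply/jacobson_radical_npow; split; [apply: (subringB rR)|apply: npowB].
split.
- split; rewrite /idealizer /=.
  + by apply/idE => x; rewrite mul1r.
  + move=> x y /idE Ix /idE Iy; apply/idE => z Jz; rewrite mulrBl.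
    by apply: JB; [apply: Ix|apply: Iy].
  by move=> x y /idE Ix /idE Iy; apply/idE => z Jz; rewrite -mulrA; apply/Ix/Iy.
- move=> x Rx; apply/idE => y /jacobson_radical_npow[Ry Ny].
  apply/jacobson_radical_npow; split; first exact: (subringM rR).
  by apply: (npowM (sRM Rx) Ny).
move=> x /idE Ix; apply: npow0_integral => j.
have /jacobson_radical_npow[Rpx _] : J (p%:R * x ^+ j).
  elim: j => [|j IHj]; last by rewrite exprS mulrCA; apply: Ix.
  rewrite mulr1; apply/jacobson_radical_npow; split; last exact: npow1_p.
  exact: subring_nat.
exact: sRM.
Qed.

End Overorder.

Local Notation chain := (radical_idealizer_chain Lam).

Lemma chain_overorder m :
  [/\ is_subring (chain m), Lam `<=` chain m & chain m `<=` npow 0].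
Proof.
elim: m => [|m [rR sLR sRM]]; first by split=> //; apply: npow0_Lam.
have [rI sRI sIM] := idealizer_overorder rR sLR sRM.
by split=> // x /sLR/sRI.
Qed.

Lemma chain_radical m x :
  jacobson_radical (chain m) x <-> chain m x /\ npow 1 x.
Proof. by have [] := chain_overorder m => *; apply: jacobson_radical_npow. Qed.

Lemma chain_le m : chain m `<=` chain m.+1.
Proof.
by have [rR sLR sRM] := chain_overorder m; case: (idealizer_overorder rR).
Qed.

(** The radical of [chain m] lies in [npow 1], so [npow (c - m.+1)] multiplies it into
    [npow (c - m)], which is inside [chain m] by induction and inside [npow 1] because [m < c]. *)
Lemma npow_chain m : (m <= c)%N -> npow (c - m) `<=` chain m.
Proof.
elim: m => [_|m IHm lt_mc]; first by rewrite subn0; apply: npow_c_Lam.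
have {}IHm := IHm (ltnW lt_mc).
have mulJ x y : npow (c - m.+1) x -> jacobson_radical (chain m) y ->
    jacobson_radical (chain m) (x * y).
  move=> Nx /chain_radical[_ Ny]; apply/chain_radical.
  have := npowM Nx Ny; rewrite addn1 -subSn // subSS => Nxy.
  split; first exact: IHm.
  by apply: npow_le Nxy; rewrite subn_gt0.
by move=> x Nx; split=> y; [|rewrite mulrC]; apply: mulJ.
Qed.

Lemma chain_c : chain c = npow 0.
Proof.
apply/seteqP; split; first by have [] := chain_overorder c.
by have := @npow_chain c (leqnn c); rewrite subnn.
Qed.

(** [t0] lies in the radical of every member, so multiplication by [t0] brings [chain m.+1] down
    into [chain m]. *)
Lemma chain_eps0 m j :
  chain m (t0 ^+ j * eps0) -> Lam (t0 ^+ (m + j) * eps0).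
Proof.
elim: m j => [//|m IHm] j [Ix _].
rewrite addSnnS; apply: IHm; rewrite exprS -mulrA mulrC.
have /chain_radical[] // : jacobson_radical (chain m) (t0 ^+ j * eps0 * t0).
apply: Ix; apply/chain_radical; split; last exact: t_dvd_t0.
by have [_ + _] := chain_overorder m; apply.
Qed.

(** Stationarity at some [m < c] would make [chain m] the maximal order, which contains [eps0]; then
    [t0 ^+ m * eps0], hence [t0 ^+ c.-1 * eps0], would lie in [Lam]. *)
Theorem is_lrad_chain : is_lrad Lam c.
Proof.
split=> [|m eq_m].
  apply/seteqP; split; first exact: chain_le.
  by rewrite chain_c; have [] := chain_overorder c.+1.
rewrite leqNgt; apply/negP => lt_mc.
have eq_chain j : chain (m + j) = chain m.
  elim: j => [|j IHj]; first by rewrite addn0.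
  by rewrite addnS [RHS]eq_m /radical_idealizer_chain !iterS -!/(chain _) IHj.
have : chain m eps0.
  rewrite -(eq_chain (c - m)%N) (subnKC (ltnW lt_mc)) chain_c => k.
  by have [b Lb ->] := eps0_max k; exists b; rewrite ?mul1r.
rewrite -[eps0 in X in X -> _]mul1r -[X in X * _](expr0 t0) => /chain_eps0.
rewrite addn0 => Lm; apply: nLam_tX_eps0.
have -> : c.-1 = ((c.-1 - m) + m)%N by rewrite subnK // -ltnS prednK.
by rewrite exprD -mulrA; apply: LM => //; apply: subringX.
Qed.

End RadicalIdealizerChain.

(** * Powers of X - 1 modulo p *)

Section ModP.
Import GRing.Theory.
Local Open Scope ring_scope.
Variables (p : nat) (p_pr : prime p).

(** Identities are proved over ['F_p], where the Frobenius map is additive and ['X - 1] cancels;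
    this carries them to integer polynomials, to be evaluated in any commutative ring. *)
Lemma poly_int_lift (f g : {poly int}) :
  map_poly (intr : int -> 'F_p) f = map_poly intr g ->
  exists w, f = g + p%:R * w.
Proof.
move=> eq_fg; set h := f - g.
have h0 i : (p %| h`_i)%Z.
  rewrite (dvdz_pcharf (pchar_Fp p_pr)) coefB rmorphB /= subr_eq0.
  by have /eqP := congr1 (fun u : {poly 'F_p} => u`_i) eq_fg; rewrite !coef_map.
exists (\poly_(i < size h) (h`_i %/ p)%Z).
suff <- : h = p%:R * (\poly_(i < size h) (h`_i %/ p)%Z) by rewrite addrC subrK.
apply/polyP => i; rewrite mulr_natl coefMn coef_poly.
case: ltnP => [_|le_hi]; last by rewrite mul0rn nth_default.
by rewrite -mulr_natr natz divzK.
Qed.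

Variables (A : comNzRingType) (x : A).
Implicit Types f g w : {poly int}.

Lemma horner_int_lift f g w : f = g + p%:R * w ->
  (map_poly intr f).[x] =
  (map_poly intr g).[x] + p%:R * (map_poly intr w).[x].
Proof.
by move->; rewrite !mulr_natl rmorphD rmorphMn /= hornerD hornerMn.
Qed.

Lemma map_subX1 (R : comNzRingType) k :
  map_poly (intr : int -> R) (('X - 1) ^+ k) = ('X - 1) ^+ k.
Proof. by rewrite rmorphXn rmorphB rmorph1 /= map_polyX. Qed.

Lemma map_sumX (R : comNzRingType) k m :
  map_poly (intr : int -> R) (\sum_(j < m) 'X ^+ (k * j)) =
  \sum_(j < m) 'X ^+ (k * j).
Proof.
by rewrite rmorph_sum; apply: eq_bigr => j _; rewrite /= rmorphXn /= map_polyX.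
Qed.

Lemma horner_subX1 k : (map_poly intr (('X - 1) ^+ k : {poly int})).[x]
  = (x - 1) ^+ k.
Proof. by rewrite map_subX1 horner_exp !hornerE. Qed.

Lemma horner_sumX k m :
  (map_poly intr (\sum_(j < m) 'X ^+ (k * j) : {poly int})).[x]
  = \sum_(j < m) x ^+ (k * j).
Proof.
by rewrite map_sumX horner_sum; apply: eq_bigr => j _; rewrite hornerXn.
Qed.

Lemma subX1_pX i : ('X - 1) ^+ (p ^ i) = 'X ^+ (p ^ i) - 1 :> {poly 'F_p}.
Proof.
have chF : [pchar {poly 'F_p}].-nat (p ^ i)%N.
  by rewrite pnatX (eq_pnat _ (pchar_poly _)) pnatE ?pchar_Fp.
by rewrite (exprDn_pchar _ _ chF) exprNn_pchar ?expr1n.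
Qed.

Lemma subX1_neq0 k : ('X - 1 : {poly 'F_p}) ^+ k != 0.
Proof. by rewrite expf_neq0 // -[1]/(1%:P) polyXsubC_eq0. Qed.

(** Multiply by [('X - 1) ^+ (p ^ i) = 'X ^+ (p ^ i) - 1] and factor ['X ^+ (p ^ i.+1) - 1] by a
    geometric sum. *)
Lemma subX1_phi i :
  ('X - 1) ^+ (p ^ i.+1 - p ^ i) = \sum_(j < p) 'X ^+ (p ^ i * j) :> {poly 'F_p}.
Proof.
have le_pi : (p ^ i <= p ^ i.+1)%N by rewrite leq_exp2l ?prime_gt1.
apply: (mulfI (subX1_neq0 (p ^ i))).
rewrite -exprD subnKC // !subX1_pX expnSr exprM subrX1.
by congr (_ * _); apply: eq_bigr => j _; rewrite exprM.
Qed.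

Lemma subX1_pX_pred i :
  ('X - 1) ^+ (p ^ i).-1 = \sum_(j < p ^ i) 'X ^+ (1 * j) :> {poly 'F_p}.
Proof.
have p_gt0 := prime_gt0 p_pr.
apply: (mulfI (subX1_neq0 1)); rewrite -exprD add1n prednK ?expn_gt0 ?p_gt0 //.
rewrite subX1_pX subrX1 expr1.
by congr (_ * _); apply: eq_bigr => j _; rewrite mul1n.
Qed.

Lemma sub1_pX i : exists w : {poly int},
  (x - 1) ^+ (p ^ i) = x ^+ (p ^ i) - 1 + p%:R * (map_poly intr w).[x].
Proof.
have [|w def_w] := @poly_int_lift (('X - 1) ^+ (p ^ i)) ('X ^+ (p ^ i) - 1).
  by rewrite map_subX1 subX1_pX rmorphB rmorph1 /= rmorphXn /= map_polyX.
exists w; rewrite -horner_subX1 (horner_int_lift def_w).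
by rewrite rmorphB rmorph1 /= rmorphXn /= map_polyX !hornerE.
Qed.

(** At 1 the power vanishes and the sum is [p], which forces [v.[1] = -1]; hence [v] acts as -1 on
    whatever [x] fixes. *)
Lemma sub1_phi i : exists2 v : {poly int}, v.[1] = -1 &
  (x - 1) ^+ (p ^ i.+1 - p ^ i) =
    \sum_(j < p) x ^+ (p ^ i * j) + p%:R * (map_poly intr v).[x].
Proof.
have [|v def_v] := @poly_int_lift (('X - 1) ^+ (p ^ i.+1 - p ^ i))
                     (\sum_(j < p) 'X ^+ (p ^ i * j)).
  by rewrite map_subX1 subX1_phi map_sumX.
exists v; last by rewrite -horner_subX1 (horner_int_lift def_v) horner_sumX.
have lt_pi : (p ^ i < p ^ i.+1)%N by rewrite ltn_exp2l ?prime_gt1.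
have := congr1 (fun f : {poly int} => f.[1]) def_v.
rewrite mulr_natl horner_exp hornerD hornerMn !hornerE subrr expr0n.
rewrite subn_eq0 leqNgt lt_pi /=.
rewrite horner_sum (eq_bigr (fun=> 1)) => [|j _]; last by rewrite hornerXn expr1n.
rewrite sumr_const card_ord -mulrnDl => /esym/eqP.
rewrite mulr0n -mulr_natr mulf_eq0 orbC Num.Theory.pnatr_eq0 -leqn0 leqNgt.
rewrite prime_gt0 //=.
by rewrite addrC addr_eq0 => /eqP.
Qed.

Lemma sub1_pX_pred i : exists w : {poly int},
  (x - 1) ^+ (p ^ i).-1 =
    \sum_(j < p ^ i) x ^+ j + p%:R * (map_poly intr w).[x].
Proof.
have [|w def_w] := @poly_int_lift (('X - 1) ^+ (p ^ i).-1)
                     (\sum_(j < p ^ i) 'X ^+ (1 * j)).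
  by rewrite map_subX1 subX1_pX_pred map_sumX.
exists w; rewrite -horner_subX1 (horner_int_lift def_w) horner_sumX.
by under eq_bigr do rewrite mul1n.
Qed.

Lemma horner_int_fixed f y : x * y = y ->
  (map_poly intr f).[x] * y = (f.[1])%:~R * y.
Proof.
move=> xy; elim/poly_ind: f => [|f d IHf].
  by rewrite rmorph0 !horner0 rmorph0.
rewrite rmorphD rmorphM /= map_polyX map_polyC !hornerE /=.
by rewrite mulrDl -mulrA xy IHf rmorphD mulrDl.
Qed.
End ModP.

(** * Idempotents of the group algebra of an abelian p-group *)

(** The left side is the exponent attached to a cyclic quotient of order [p ^ i.+1]. Passing to the
    next order increases it by [q * (p - 1) ^ 2 * l], with [q] and [l] as in the proof. *)
Lemma chain_length_mono (p n a i : nat) : (1 < p)%N -> (i < a <= n)%N ->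
  ((p ^ i.+1 - p ^ i) * (n - i.+1) + p ^ i <=
   p ^ (a - 1) + (p ^ a - p ^ (a - 1)) * (n - a))%N.
Proof.
move=> p_gt1 /andP[lt_ia le_an]; case: a lt_ia le_an => // a; rewrite ltnS.
rewrite subn1 /= => le_ia lt_an; rewrite -(subnKC le_ia) in lt_an *.
elim: (a - i)%N lt_an => [|k IHk] lt_an; first by rewrite addn0 addnC.
apply: leq_trans (IHk _) _; first by rewrite ltnW // -addnS.
rewrite addnS !expnS; set q := (p ^ (i + k))%N.
have [l ->] : exists l, n = (i + k).+2 + l.
  by exists (n - (i + k).+2)%N; rewrite subnKC // -addnS.
have -> : ((i + k).+2 + l - (i + k).+1 = l.+1)%N by lia.
have -> : ((i + k).+2 + l - (i + k).+2 = l)%N by lia.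
have [r ->] : exists r, p = r.+2 by exists p.-2; lia.
rewrite !mulSn; nia.
Qed.

(** Serves the trivial quotient, where the uniformizer is [p] and [p ^ n] clears the denominator of
    the average over [P]. *)
Lemma leq_chain_length (p n a : nat) : (1 < p)%N -> (0 < a <= n)%N ->
  (n <= p ^ (a - 1) + (p ^ a - p ^ (a - 1)) * (n - a))%N.
Proof.
move=> p_gt1 a_n; apply: leq_trans (chain_length_mono p_gt1 a_n).
rewrite expn1 expn0; have [m ->] : exists m, n = m.+1 by exists n.-1; lia.
by have [r ->] : exists r, p = r.+2; [exists p.-2; lia|nia].
Qed.

Section Cells.
Import GRing.Theory.
Local Open Scope ring_scope.
Variables (A : comNzRingType) (gT : finGroupType) (d : gT -> A).
Variables (p : nat) (p_pr : prime p) (ip : A) (P : {group gT}).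
Hypothesis d1 : d 1%g = 1.
Hypothesis dM : {morph d : x y / (x * y)%g >-> x * y}.
Hypothesis p_ip : p%:R * ip = 1.
Hypothesis pgrpP : (p.-group P)%g.
Hypothesis abelP : abelian P.
Implicit Types (x y g h : gT) (U W : {group gT}) (S : {set gT}) (u v : A).

Lemma dX x k : d (x ^+ k)%g = d x ^+ k.
Proof. by elim: k => [|k IHk]; rewrite ?d1 // expgS exprS dM IHk. Qed.

Lemma pX_ipX k : p%:R ^+ k * ip ^+ k = 1.
Proof. by rewrite -exprMn p_ip expr1n. Qed.

Lemma pX_inj k u v : p%:R ^+ k * u = p%:R ^+ k * v -> u = v.
Proof.
move=> /(congr1 (fun w => ip ^+ k * w)); rewrite !mulrA [ip ^+ k * _]mulrC.
by rewrite pX_ipX !mul1r.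
Qed.

Definition nsum (W : {set gT}) : A := \sum_(x in W) d x.

Definition average (W : {set gT}) : A := ip ^+ logn p #|W| * nsum W.

Lemma nsum_fixed W x : x \in W -> d x * nsum W = nsum W.
Proof.
move=> Wx; rewrite /nsum mulr_sumr [RHS](reindex_inj (mulgI x)) /=.
by apply: eq_big => y; rewrite ?groupMl // => _; rewrite dM.
Qed.

Lemma average_fixed W x : x \in W -> d x * average W = average W.
Proof. by move=> Wx; rewrite mulrCA nsum_fixed. Qed.

Lemma nsum_mul (W : {set gT}) u :
  (forall x, x \in W -> d x * u = u) -> nsum W * u = #|W|%:R * u.
Proof.
move=> fixu; rewrite /nsum mulr_suml (eq_bigr (fun=> u)) //.
by rewrite sumr_const mulr_natl.
Qed.

Lemma card_pX W : W \subset P -> #|W|%:R = p%:R ^+ logn p #|W| :> A.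
Proof. by move=> sWP; rewrite {1}(card_pgroup (pgroupS sWP pgrpP)) natrX. Qed.

Lemma average_mul W u : W \subset P ->
  (forall x, x \in W -> d x * u = u) -> average W * u = u.
Proof.
move=> sWP fixu; rewrite /average -mulrA nsum_mul // card_pX //.
by rewrite mulrCA mulrA pX_ipX mul1r.
Qed.

Lemma nsum_average W : W \subset P -> p%:R ^+ logn p #|W| * average W = nsum W.
Proof. by move=> sWP; rewrite mulrA pX_ipX mul1r. Qed.

Lemma cycle_fixed x u : d x * u = u -> forall z, z \in <[x]>%g -> d z * u = u.
Proof.
move=> fixu z /cycleP[k ->]; rewrite dX.
by elim: k => [|k IHk]; rewrite ?mul1r // exprSr -mulrA fixu.
Qed.

Lemma mul_sumX_fixed k u v : v ^+ k * u = u ->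
  v * ((\sum_(j < k) v ^+ j) * u) = (\sum_(j < k) v ^+ j) * u.
Proof.
move=> fixu; apply/eqP; rewrite -subr_eq0 -{2}(mul1r (_ * u)) -mulrBl mulrA.
by rewrite -subrX1 mulrBl fixu mul1r subrr.
Qed.

(** Each side is fixed by [<[x]>], so the other acts on it as the order of [x]; that order is a
    power of [p] and cancels. *)
Lemma sum_cycle x : x \in P -> \sum_(j < #[x]%g) d x ^+ j = nsum <[x]>%g.
Proof.
move=> Px; have sxP : <[x]>%g \subset P by rewrite cycle_subG.
apply: (@pX_inj (logn p #[x]%g)); rewrite -[p%:R ^+ _](card_pX sxP) -nsum_mul.
  rewrite mulrC mulr_suml (eq_bigr (fun=> nsum <[x]>%g)) => [|j _].
    by rewrite sumr_const card_ord mulr_natl.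
  by rewrite -dX nsum_fixed ?mem_cycle.
apply: cycle_fixed.
have := @mul_sumX_fixed #[x]%g 1 (d x); rewrite !mulr1; apply.
by rewrite -dX expg_order.
Qed.

Lemma sum_order_p x : x \in P -> #[x]%g = p ->
  ip * \sum_(j < p) d x ^+ j = average <[x]>%g.
Proof.
move=> Px ox; have := sum_cycle Px; rewrite ox => ->; rewrite /average -orderE ox.
by rewrite logn_prime // eqxx expr1.
Qed.

(** The value 1 outside [P] makes the atom of a set vanish unless the set contains every element
    outside [P]. *)
Definition cycle_average x : A := if x \in P then average <[x]>%g else 1.

(* The atoms of the Boolean algebra generated by the idempotents
   [cycle_average x]; the nonzero ones are the primitive idempotents of the
   rational group algebra of [P]. *)
Definition atom S : A :=
  \prod_x (if x \in S then cycle_average x else 1 - cycle_average x).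

Lemma sum_atom : \sum_(S : {set gT}) atom S = 1.
Proof.
by rewrite -bigA_distr big1 // => x _; rewrite /= addrCA subrr addr0.
Qed.

Lemma average_cycle_fixed x u : x \in P ->
  (average <[x]>%g * u = u) <-> (d x * u = u).
Proof.
move=> Px; split=> [<-|fixu].
  by rewrite mulrA average_fixed // cycle_id.
by apply: average_mul (cycle_fixed fixu); rewrite cycle_subG.
Qed.

Lemma cycle_average_idem x : cycle_average x * cycle_average x = cycle_average x.
Proof.
rewrite /cycle_average; case: ifP => [Px|_]; last by rewrite mul1r.
by apply/average_cycle_fixed => //; rewrite average_fixed ?cycle_id.
Qed.

Lemma cycle_average_atom x S :
  cycle_average x * atom S = if x \in S then atom S else 0.
Proof.
rewrite /atom (bigD1 x) //= mulrA; case: ifP => _.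
  by rewrite cycle_average_idem.
by rewrite mulrBr cycle_average_idem mulr1 subrr mul0r.
Qed.

Lemma atom_cases x S : x \in P ->
  d x * atom S = atom S \/ average <[x]>%g * atom S = 0.
Proof.
move=> Px; have := cycle_average_atom x S; rewrite /cycle_average Px.
by case: ifP => _; [left; apply/average_cycle_fixed|right].
Qed.

(** If some [x] in [W] does not fix the atom, [average <[x]>] kills it, and [average W] is a
    multiple of [average <[x]>]. *)
Lemma average_atom W S : W \subset P ->
  average W * atom S = atom S \/ average W * atom S = 0.
Proof.
move=> sWP; have [/forall_inP fixW|] :=
  boolP [forall (x | x \in W), d x * atom S == atom S].
  by left; apply: average_mul => // x /fixW/eqP.
rewrite negb_forall_in => /exists_inP[x Wx /eqP nfix].
have Px := fintype.subsetP sWP x Wx.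
have [//|av0] := atom_cases S Px; right.
have <- : average <[x]>%g * average W = average W.
  by apply/average_cycle_fixed => //; apply: average_fixed.
by rewrite mulrAC av0 mul0r.
Qed.

(** Every factor of [atom S] acts as 1 on [u]; as the atom is nonzero, its own behaviour under [x]
    tells which factor occurs. *)
Lemma atom_absorb S u : atom S != 0 ->
  (forall x, x \in P -> d x * atom S = atom S -> d x * u = u) ->
  (forall x, x \in P -> d x * atom S != atom S -> average <[x]>%g * u = 0) ->
  atom S * u = u.
Proof.
move=> nzS fixu killu; pose E v := v * u = u; rewrite -/(E (atom S)).
rewrite {1}/atom; apply: big_ind => [|v w Ev Ew|x _]; rewrite /E ?mul1r //.
  by rewrite -mulrA Ew.
have := cycle_average_atom x S; rewrite /cycle_average.
case Px: (x \in P); case: ifP => // _.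
- by move=> /average_cycle_fixed fixS; apply/average_cycle_fixed/fixu/fixS.
- move=> av0; rewrite mulrBl mul1r killu ?subr0 //.
  by apply: contraNneq nzS => /average_cycle_fixed <-; rewrite // av0.
- by rewrite !mul1r.
by rewrite mul1r => S0; rewrite S0 eqxx in nzS.
Qed.

(** * Fixers of atoms and their cyclic quotients *)

Definition fixer u : {set gT} := [set x in P | d x * u == u].

Lemma fixer_group_set u : group_set (fixer u).
Proof.
apply/group_setP; split=> [|x y]; first by rewrite inE group1 d1 mul1r /=.
rewrite !inE => /andP[Px /eqP fx] /andP[Py /eqP fy].
by rewrite groupM //= dM -mulrA fy fx.
Qed.

Canonical fixer_group u := Group (fixer_group_set u).

Lemma fixer_sub u : fixer u \subset P.
Proof. by apply/fintype.subsetP => x; rewrite inE => /andP[]. Qed.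

Lemma fixerP u x : reflect (x \in P /\ d x * u = u) (x \in fixer u).
Proof. by rewrite inE; apply: (iffP andP) => -[Px /eqP]. Qed.

(** The product is fixed by [x], so it absorbs [average <[x]>], which annihilates the atom. *)
Lemma sumX_atom S x : x \in P -> x \notin fixer (atom S) ->
  (x ^+ p)%g \in fixer (atom S) -> (\sum_(j < p) d x ^+ j) * atom S = 0.
Proof.
move=> Px nUx /fixerP[_]; rewrite dX => /mul_sumX_fixed.
move=> /(average_cycle_fixed _ Px) <-.
have [fixS|] := atom_cases S Px; last by move=> av0; rewrite mulrCA av0 mulr0.
by case/negP: nUx; apply/fixerP.
Qed.

(* Summing over the [p] lines spanned by the [x y^j] in an elementary abelian
   group of rank 2 gives [p] plus multiples of the sums over the powers of
   [y^k], [0 < k < p]. *)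
Lemma atom_rank1 S x y : atom S != 0 -> x \in P -> y \in P ->
  (x ^+ p)%g \in fixer (atom S) -> (y ^+ p)%g \in fixer (atom S) ->
  y \notin fixer (atom S) -> exists j, (x * y ^+ j)%g \in fixer (atom S).
Proof.
move=> nzS Px Py Uxp Uyp nUy; apply: contrapT => noj.
have cxy : commute x y by apply: (centsP abelP).
have nU j : (x * y ^+ j)%g \notin fixer (atom S).
  by apply/negP => Uj; apply: noj; exists j.
have sum0 j : (\sum_(k < p) d (x * y ^+ j)%g ^+ k) * atom S = 0.
  apply: sumX_atom => //; first by rewrite groupM ?groupX.
  rewrite expgMn; last exact: commuteX.
  by rewrite groupM // -expgM mulnC expgM groupX.
case/eqP: nzS; apply: (@pX_inj 1); rewrite mulr0 expr1.
transitivity (\sum_(j < p) (\sum_(k < p) d (x * y ^+ j)%g ^+ k) * atom S);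
  last by rewrite big1.
rewrite -mulr_suml exchange_big /= mulr_suml.
have p_gt0 := prime_gt0 p_pr.
rewrite (bigD1 (Ordinal p_gt0)) //= [X in _ + X]big1 => [|k nzk].
  by rewrite addr0 sumr_const card_ord.
transitivity (d x ^+ k * ((\sum_(j < p) d (y ^+ k)%g ^+ j) * atom S)).
  rewrite mulrA mulr_sumr; congr (_ * _); apply: eq_bigr => j _.
  by rewrite dM !dX exprMn -!exprM mulnC.
rewrite sumX_atom ?mulr0 //; first by rewrite groupX.
  2: by rewrite -expgM mulnC expgM groupX.
have k_gt0 : (0 < k)%N by rewrite lt0n.
(* [k] is invertible modulo [p] and [y ^+ p] is in the fixer, so [y ^+ k] cannot be there without
   [y]. *)
apply: contra nUy => Uyk; case: (egcdnP p k_gt0) => m l.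
have /eqP -> : coprime k p.
  by rewrite coprime_sym prime_coprime // gtnNdvd.
move=> def_kp _; have : (y ^+ (m * k))%g \in fixer (atom S).
  by rewrite mulnC expgM groupX.
by rewrite def_kp addn1 expgSr mulnC expgM groupMl // groupX.
Qed.


(** Otherwise the quotient contains an elementary abelian [E] of order [p ^ 2], and [atom_rank1]
    puts all of [E] into [<[Y]>], of order [p], for a nontrivial [Y] in [E]. *)
Lemma cyclic_quotient_fixer S : atom S != 0 -> cyclic (P / fixer (atom S)).
Proof.
move=> nzS; set U := fixer_group (atom S); rewrite -[fixer _]/(U : {set gT}).
have sUP : U \subset P by apply: fixer_sub.
have nUP : P \subset ('N(U))%g by apply: sub_abelian_norm.
rewrite abelian_rank1_cyclic ?quotient_abelian // leqNgt; apply/negP.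
case/rank_geP=> E /nElemP[r /pnElemP[sE abE logE]].
have pE : (p.-group E)%g by apply: pgroupS sE (quotient_pgroup _ pgrpP).
have ntE : E :!=: 1%g.
  by apply/eqP => E1; move: logE; rewrite E1 cards1 logn1.
have [r_pr r_dv _] := pgroup_pdiv (abelem_pgroup abE) ntE.
have {r_pr r_dv} def_r : r = p.
  by have /pgroupP := pE => /(_ r r_pr r_dv); rewrite inE => /eqP.
rewrite def_r {r def_r} in abE logE.
have [Y EY ntY] := trivgPn _ ntE.
have [_ expE] := abelemP p_pr abE.
have cosetE X : X \in E ->
    exists x, [/\ x \in P, X = coset U x & (x ^+ p)%g \in U].
  move=> EX; have /morphimP[x Nx Px def_X] := fintype.subsetP sE X EX.
  exists x; split=> //; apply: coset_idr; first exact: groupX.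
  by rewrite morphX //= -def_X expE.
have [y [Py def_Y Uyp]] := cosetE Y EY.
have nUy : y \notin U by apply: contra ntY => Uy; rewrite def_Y coset_id.
suff sEY : E \subset <[Y]>%g.
  have := subset_leq_card sEY; rewrite -orderE (abelem_order_p abE) //.
  rewrite (card_pgroup pE) logE -{2}(expn1 p) leq_exp2l //.
  exact: prime_gt1.
apply/fintype.subsetP => X EX; have [x [Px def_X Uxp]] := cosetE X EX.
have [j Uxyj] := atom_rank1 nzS Px Py Uxp Uyp nUy.
have := coset_id Uxyj.
rewrite morphM ?(fintype.subsetP nUP) ?groupX //.
rewrite morphX ?(fintype.subsetP nUP) //=.
rewrite -def_X -def_Y => /(canRL (mulgK _)) ->; rewrite mul1g groupV.
exact: mem_cycle.
Qed.

Lemma fixer_generator S : atom S != 0 -> exists g i,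
  [/\ g \in P, (#|fixer (atom S)| * p ^ i)%N = #|P|,
      forall k, (g ^+ k \in fixer (atom S))%g = (p ^ i %| k)%N &
      forall x, x \in P -> exists k,
        exists2 u, u \in fixer (atom S) & x = (g ^+ k * u)%g].
Proof.
move=> nzS; have /cyclicP[X def_X] := cyclic_quotient_fixer nzS.
set U := fixer_group (atom S) in X def_X *.
have sUP : U \subset P by apply: fixer_sub.
have nUP : P \subset ('N(U))%g by apply: sub_abelian_norm.
have [g Ng [Pg defX]] : exists2 g, g \in ('N(U))%g & g \in P /\ X = coset U g.
  have : X \in (P / U)%g by rewrite def_X cycle_id.
  by case/morphimP=> g Ng Pg ->; exists g.
have [i oPU] : exists i, #|(P / U)%g| = (p ^ i)%N.
  by exists (logn p #|(P / U)%g|); rewrite -card_pgroup // quotient_pgroup.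
exists g, i; split=> // [|k|x Px].
- by rewrite -oPU card_quotient // Lagrange.
- rewrite -oPU def_X -orderE order_dvdn defX -morphX //.
  apply/idP/eqP => [|/coset_idr]; first exact: coset_id.
  by apply; apply: groupX.
have : coset U x \in (P / U)%g by apply: mem_quotient.
rewrite def_X => /cycleP[k]; rewrite defX -morphX // => eq_xg.
exists k, (g ^- k * x)%g; last by rewrite mulKVg.
have Nx := fintype.subsetP nUP x Px.
apply: coset_idr; first by rewrite groupM ?groupV ?groupX.
by rewrite morphM ?groupV ?groupX // morphV ?groupX //= eq_xg mulVg.
Qed.

(** * Closed form of the idempotent of a cyclic quotient *)

Definition phi_sum g i : A := \sum_(j < p) d g ^+ (p ^ i * j).

(** The exponent is shifted by one: the intended [g] has order [p ^ i.+1] modulo [U]. The cell is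
    then the average over [U] minus that over the subgroup generated by [U] and [g ^+ (p ^ i)]. *)
Definition cell U g i : A := average U * (1 - ip * phi_sum g i).

Lemma phi_sumE g i : phi_sum g i = \sum_(j < p) (d g ^+ (p ^ i)) ^+ j.
Proof. by apply: eq_bigr => j _; rewrite exprM. Qed.

Section Cell.
Variables (U : {group gT}) (g : gT) (i : nat).
Hypotheses (sUP : U \subset P) (Ugp : (g ^+ (p ^ i.+1))%g \in U).

Local Notation x := (d g).
Local Notation N := (nsum U).
Local Notation s := (phi_sum g i).
Local Notation m := (logn p #|U|).

Lemma cell_gX_fixed : (x ^+ (p ^ i)) ^+ p * N = N.
Proof. by rewrite -exprM -expnSr -dX nsum_fixed. Qed.

Lemma gX_phi_sum : x ^+ (p ^ i) * (s * N) = s * N.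
Proof. by rewrite phi_sumE mul_sumX_fixed // cell_gX_fixed. Qed.

Lemma phi_sum_cell : s * (N * (1 - ip * s)) = 0.
Proof.
have ssN : s * (s * N) = p%:R * (s * N).
  rewrite {1}phi_sumE mulr_suml (eq_bigr (fun=> s * N)) => [|j _].
    by rewrite sumr_const card_ord mulr_natl.
  elim: {j}(j : nat) => [|j IHj]; first by rewrite mul1r.
  by rewrite exprSr -mulrA gX_phi_sum.
transitivity (s * N - ip * (s * (s * N))); first ring.
by rewrite ssN mulrA [ip * _]mulrC p_ip mul1r subrr.
Qed.

Lemma phi_sum_mul_cell : s * cell U g i = 0.
Proof. by rewrite /cell /average -mulrA mulrCA phi_sum_cell mulr0. Qed.

(* [(x-1)^(p^(i+1)-p^i)] acts on the cell as [p] times a unit. *)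
Lemma cell_phi_power :
  exists2 v : {poly int}, v.[1] = -1 &
    (x - 1) ^+ ((p ^ i.+1 - p ^ i) * m) * cell U g i =
    (map_poly intr v).[x] ^+ m * (N * (1 - ip * s)).
Proof.
have [v v1 def_v] := sub1_phi p_pr x i; exists v => //.
rewrite exprM def_v -/(phi_sum g i); set w := _.[x].
have phiX k : (s + p%:R * w) ^+ k * (N * (1 - ip * s)) =
              (p%:R * w) ^+ k * (N * (1 - ip * s)).
  elim: k => [|k IHk]; rewrite ?expr0 // exprSr -mulrA mulrDl phi_sum_cell add0r.
  by rewrite mulrCA IHk exprS; ring.
rewrite /cell /average -mulrA mulrCA phiX exprMn mulrA mulrA [ip ^+ _ * _]mulrC.
by rewrite pX_ipX mul1r.
Qed.

Variables (Lam : set A) (rLam : is_subring Lam).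
Hypothesis Lam_d : forall y, Lam (d y).

Let LamX k : Lam (x ^+ k).
Proof. by apply: subringX. Qed.

Lemma Lam_nsum (W : {set gT}) : Lam (nsum W).
Proof. by apply: subring_sum. Qed.

Lemma Lam_phi_sum : Lam s.
Proof. by apply: subring_sum. Qed.

Lemma Lam_sub1 k : Lam ((x - 1) ^+ k).
Proof.
apply: subringX => //; apply: (subringB rLam) => //; exact: (subring1 rLam).
Qed.

(** After [cell_phi_power] only the denominator of [ip * s] is left. The further power is [h - 1]
    plus a multiple of [p]: [h - 1] kills [s * N], and [p] cancels [ip]. *)
Lemma Lam_cell_power :
  Lam ((x - 1) ^+ ((p ^ i.+1 - p ^ i) * m + p ^ i) * cell U g i).
Proof.
have [v _ def_v] := cell_phi_power; have [w def_w] := sub1_pX p_pr x i.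
rewrite exprD mulrAC def_v def_w.
set v' := _.[x] ^+ m; set w' := _.[x]; set h := x ^+ (p ^ i).
have -> : v' * (N * (1 - ip * s)) * (h - 1 + p%:R * w') =
    v' * (N * (h - 1) + ip * (s * N - h * (s * N))
      + w' * N * (p%:R - p%:R * ip * s)).
  by ring.
rewrite gX_phi_sum subrr mulr0 addr0 p_ip mul1r.
have Lp k : Lam k%:R by apply: subring_nat.
have LN := Lam_nsum U; have Ls := Lam_phi_sum.
apply: (subringM rLam); first by apply: subringX => //; apply: subring_horner.
apply: subringD => //.
  apply: (subringM rLam) => //; apply: (subringB rLam).
    exact: LamX.
  exact: (subring1 rLam).
apply: (subringM rLam); last exact: (subringB rLam).
by apply: (subringM rLam) => //; apply: subring_horner.
Qed.

End Cell.

(** Atom and cell act on each other as 1. For [x] outside [U], some power of [x] is [g ^+ (p ^ i)]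
    times an element of [U], so the product of the averages over [<[x]>] and [U] is fixed by
    [g ^+ (p ^ i)] and killed by [1 - ip * phi_sum g i]. *)
Lemma atom_cell S g i : atom S != 0 -> g \in P ->
  (forall k, (g ^+ k \in fixer (atom S))%g = (p ^ i.+1 %| k)%N) ->
  (forall x, x \in P -> exists k,
     exists2 u, u \in fixer (atom S) & x = (g ^+ k * u)%g) ->
  atom S = cell (fixer_group (atom S)) g i.
Proof.
move=> nzS Pg gU genP; set U := fixer_group (atom S).
have sUP : U \subset P by apply: fixer_sub.
have Ugp : (g ^+ (p ^ i.+1))%g \in U by rewrite gU.
have fixU x : x \in U -> d x * cell U g i = cell U g i.
  by move=> Ux; rewrite /cell mulrA average_fixed.
have defS : cell U g i * atom S = atom S.
  rewrite /cell mulrBr mulr1 mulrBl average_mul //; last by move=> x /fixerP[].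
  rewrite -!mulrA phi_sumE; under eq_bigr do rewrite -dX.
  rewrite sumX_atom ?mulr0 ?subr0 ?(groupX _ Pg) //.
    by rewrite gU gtnNdvd ?expn_gt0 ?prime_gt0 // ltn_exp2l ?prime_gt1.
  by rewrite -expgM -expnSr gU.
rewrite -defS mulrC; apply: atom_absorb => // [x Px fixx|x Px nfix].
  by apply: fixU; apply/fixerP.
have nUx : x \notin U by apply/negP => /fixerP[_ /eqP fixx]; rewrite fixx in nfix.
have [m [u Uu def_xm]] : exists m, exists2 u, u \in U &
    (x ^+ m = g ^+ (p ^ i) * u)%g.
  have [k [u Uu def_x]] := genP x Px.
  have ndvd : ~~ (p ^ i.+1 %| k)%N.
    by rewrite -gU; apply: contra nUx => Uk; rewrite def_x groupM.
  have k_gt0 : (0 < k)%N by case: posnP ndvd => // ->; rewrite dvdn0.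
  case: (egcdnP (p ^ i.+1) k_gt0) => b l def_gcd _.
  have [r le_ri def_r] : exists2 r, (r <= i)%N & gcdn k (p ^ i.+1) = (p ^ r)%N.
    have /(dvdn_pfactor _ _ p_pr)[r le_r def_r] := dvdn_gcdr k (p ^ i.+1).
    exists r => //; rewrite leqNgt; apply: contra ndvd => lt_ir.
    by rewrite (dvdn_trans _ (dvdn_gcdl k (p ^ i.+1))) // def_r dvdn_exp2l.
  (* Modulo [p ^ i.+1], the Bezout multiple of [k] is [p ^ r]; the factor [f] raises it to
     [p ^ i]. *)
  pose f := (p ^ (i - r))%N.
  exists (b * f)%N, (g ^+ (l * p ^ i.+1 * f) * u ^+ (b * f))%g.
    by apply: groupM; [rewrite gU mulnAC dvdn_mull|apply: groupX].
  have cgu : commute (g ^+ k) u.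
    apply: (centsP abelP); first exact: groupX.
    by have /fixerP[] := Uu.
  rewrite def_x expgMn // -expgM mulgA -expgD; congr (_ ^+ _ * _)%g.
  rewrite mulnA [(k * b)%N]mulnC def_gcd def_r mulnDl addnC; congr (_ + _)%N.
  by rewrite /f -expnD subnKC.
rewrite /cell mulrA mulrBr mulr1; set w := average _ * average U.
suff -> : w * (ip * phi_sum g i) = w by rewrite subrr.
have fixw : d g ^+ (p ^ i) * w = w.
  transitivity (d (g ^+ (p ^ i) * u)%g * w).
    by rewrite dM -mulrA [d u * w]mulrCA average_fixed // dX.
  rewrite -def_xm /w mulrA average_fixed // mem_cycle //.
rewrite mulrCA phi_sumE mulrC mulr_sumr.
rewrite (eq_bigr (fun=> w)) => [|j _].
  by rewrite sumr_const card_ord -mulr_natl mulrAC p_ip mul1r.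
by elim: {j}(j : nat) => [|j IHj]; rewrite ?mulr1 // exprS mulrCA IHj.
Qed.

(** * Uniformizers and the extremal idempotent *)

Section Uniformizers.
Variables (n a : nat) (Lam : set A) (rLam : is_subring Lam).
Hypothesis cardP : #|P| = (p ^ n)%N.
Hypothesis expP : exponent P = (p ^ a)%N.
Hypothesis a_gt0 : (0 < a)%N.
Hypothesis Lam_d : forall y, Lam (d y).

Local Notation c := (p ^ (a - 1) + (p ^ a - p ^ (a - 1)) * (n - a))%N.

Lemma leq_exponent : (a <= n)%N.
Proof.
by rewrite -(@leq_exp2l p) ?prime_gt1 // -expP -cardP dvdn_leq // exponent_dvdn.
Qed.

(** The uniformizer is [p] when the atom is zero or fixed by all of [P], and otherwise [d g - 1]
    with [g] a generator modulo the fixer. *)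
Lemma atom_uniformizer S : exists t,
  [/\ Lam t,
      exists2 b, Lam b & p%:R * atom S = t * b * atom S &
      forall x, x \in P ->
        exists2 b, Lam b & (d x - 1) * atom S = t * b * atom S] /\
  [/\ Lam (p%:R ^+ n * atom S),
      exists2 b, Lam b & t ^+ (p ^ a) = p%:R * b &
      Lam (t ^+ c * atom S)].
Proof.
have [L1 LB LM] := rLam.
have L0 := subring0 rLam; have LX := subringX rLam; have Lp := subring_nat rLam.
have Lpb : exists2 b, Lam b & p%:R ^+ (p ^ a) = p%:R * b.
  exists (p%:R ^+ (p ^ a).-1); first exact: LX.
  by rewrite -exprS prednK // expn_gt0 prime_gt0.
have [S0|nzS] := eqVneq (atom S) 0.
  exists p%:R; split; split; rewrite ?S0 ?mulr0 //.
  - by exists 1; rewrite ?mulr0.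
  by move=> x _; exists 1; rewrite ?mulr0.
have [g [i [Pg cardU gU genP]]] := fixer_generator nzS.
set U := fixer_group (atom S) in cardU gU genP.
have sUP : U \subset P by apply: fixer_sub.
have fixS x : x \in U -> d x * atom S = atom S by case/fixerP.
have p_gt0 := prime_gt0 p_pr; have p_gt1 := prime_gt1 p_pr.
case: i => [|i] in cardU gU genP.
  have defU x : x \in P -> x \in U.
    move=> Px; have [k [u Uu ->]] := genP x Px.
    by apply: groupM => //; rewrite gU dvd1n.
  have defS : atom S = average P.
    rewrite -[LHS](average_mul (subxx P)) => [|x /defU/fixS] //.
    rewrite mulrC; apply: atom_absorb => // x Px; first by rewrite average_fixed.
    by rewrite fixS ?eqxx ?defU.
  have pS : p%:R ^+ n * atom S = nsum P.
    have := nsum_average (subxx P).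
    by rewrite -defS cardP pfactorK.
  exists p%:R; split; split=> //.
  - by exists 1; rewrite ?mulr1.
  - move=> x Px; exists 0; first by [].
    by rewrite mulrBl fixS ?defU // mul1r subrr mulr0 mul0r.
  - by rewrite pS; apply: Lam_nsum.
  have a_n : (0 < a <= n)%N by rewrite a_gt0 leq_exponent.
  rewrite -(subnK (leq_chain_length p_gt1 a_n)).
  rewrite exprD -mulrA pS; apply: (subringM rLam); first exact: LX.
  exact: Lam_nsum.
have Ugp : (g ^+ (p ^ i.+1))%g \in U by rewrite gU.
have defS := atom_cell nzS Pg gU genP.
have n_i : (logn p #|U| + i.+1 = n)%N.
  have := congr1 (logn p) cardU; rewrite cardP lognM ?expn_gt0 ?p_gt0 //.
  by rewrite !pfactorK.
have lt_ia : (i < a)%N.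
  have : (p ^ i.+1 %| p ^ a)%N.
    by rewrite -gU -expP expg_exponent // group1.
  by rewrite dvdn_Pexp2l.
exists (d g - 1); split; split.
- exact: LB.
(* [phi_sum g i] is congruent to [p] modulo [d g - 1] and kills the atom. *)
- have [b Lb def_b] : exists2 b, Lam b & phi_sum g i = p%:R - (d g - 1) * b.
    exists (- \sum_(j < p) \sum_(k < p ^ i * j) d g ^+ k).
      apply: subringN => //; apply: subring_sum => // j _.
      by apply: subring_sum => // k _; apply: LX.
    rewrite mulrN opprK mulr_sumr /phi_sum.
    under [in RHS]eq_bigr do rewrite -subrX1.
    by rewrite sumrB sumr_const card_ord addrC subrK.
  exists b => //; apply/eqP; rewrite -subr_eq0 -mulrBl -def_b defS.
  by rewrite phi_sum_mul_cell.
- move=> x Px; have [k [u Uu ->]] := genP x Px.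
  exists (\sum_(j < k) d g ^+ j).
    by apply: subring_sum => // j _; apply: LX.
  by rewrite -subrX1 dM dX mulrBl -mulrA fixS // mulrBl.
- rewrite -n_i addnS exprS exprD defS /cell.
  set m := logn _ _.
  rewrite (_ : _ * _ = p%:R ^+ i * (p%:R ^+ m * average U)
      * (p%:R - p%:R * ip * phi_sum g i)).
    rewrite nsum_average // p_ip mul1r; apply: LM.
      by apply: (subringM rLam); [apply: LX|apply: Lam_nsum].
    by apply: (subringB rLam) => //; apply: Lam_phi_sum.
  ring.
- have [w def_w] := sub1_pX p_pr (d g) a.
  exists ((map_poly intr w).[d g]); first exact: subring_horner.
  rewrite def_w -dX -expP expg_exponent // d1 subrr; exact: add0r.
have le_c : ((p ^ i.+1 - p ^ i) * logn p #|U| + p ^ i <= c)%N.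
  have -> : logn p #|U| = (n - i.+1)%N by rewrite -n_i addnK.
  by apply: chain_length_mono => //; rewrite lt_ia leq_exponent.
rewrite -(subnK le_c) exprD -mulrA; apply: (subringM rLam); first exact: Lam_sub1.
by rewrite defS; apply: Lam_cell_power.
Qed.

(* The cell of a complement of a cyclic direct factor of maximal order; up to
   a unit, [(d g - 1)^(c-1) * eps0] is [ip * nsum P] modulo [Lam]. *)
Lemma extremal_cell : exists g eps0,
  [/\ g \in P,
      forall S, exists2 b, Lam b & eps0 * atom S = b * atom S &
      Lam ((d g - 1) ^+ c.-1 * eps0) -> Lam (ip * nsum P)].
Proof.
have [L1 LB LM] := rLam.
have L0 := subring0 rLam; have LX := subringX rLam; have Lp := subring_nat rLam.
have p_gt0 := prime_gt0 p_pr; have p_gt1 := prime_gt1 p_pr.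
have [g Pg og] := exponent_witness (abelian_nil abelP).
have /splitsP[U /complP[tiU defP]] := abelian_splits Pg (esym og) abelP.
have sUP : U \subset P by rewrite -defP mulG_subr.
have le_an := leq_exponent.
case: a expP a_gt0 le_an => [//|i] expPi _ lt_in.
have {}og : #[g]%g = (p ^ i.+1)%N by rewrite -og.
have gU1 : (g ^+ (p ^ i.+1))%g \in U by rewrite -og expg_order group1.
exists g, (cell U g i); split=> // [S|].
  (* Both averages that make up the cell act on an atom as 0 or 1. *)
  have av01 (W : {group gT}) : W \subset P ->
      exists2 b, Lam b & average W * atom S = b * atom S.
    by case/(average_atom S)=> ->; [exists 1|exists 0]; rewrite ?mul1r ?mul0r.
  have Ph : (g ^+ (p ^ i))%g \in P by apply: groupX.
  have oh : #[(g ^+ (p ^ i))%g]%g = p.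
    rewrite orderXdiv og ?dvdn_exp2l // expnS mulnK //.
    by rewrite expn_gt0 p_gt0.
  have [|b Lb def_b] := av01 <[g ^+ (p ^ i)]>%G; first by rewrite cycle_subG.
  have [e Le def_e] := av01 U sUP.
  exists (e * (1 - b)); first by apply: LM => //; apply: LB.
  move: def_b; rewrite /= -sum_order_p // dX -phi_sumE => def_b.
  transitivity (average U * atom S - ip * phi_sum g i * atom S * average U).
    by rewrite /cell; ring.
  by rewrite def_b -[_ * average U]mulrA [_ * average U]mulrC def_e; ring.
have n_i : (logn p #|U| + i.+1 = n)%N.
  have := TI_cardMg tiU; rewrite defP cardP -orderE og.
  move/(congr1 (logn p)); rewrite lognM ?expn_gt0 ?p_gt0 //.
  by rewrite !pfactorK // addnC => ->.
have [v v1 def_v] := cell_phi_power gU1.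
have [w def_w] := sub1_pX_pred p_pr (d g) i.+1.
have [f _ def_f] := sub1_phi p_pr (d g) i.
rewrite subn1 /=; have -> : (n - i.+1 = logn p #|U|)%N by rewrite -n_i addnK.
set m := logn p #|U|; set y := d g.
(* The exponent [c.-1] is one short of the exponent in [Lam_cell_power]. *)
have -> : (p ^ i + (p ^ i.+1 - p ^ i) * m).-1 =
          ((p ^ i.+1 - p ^ i) * m + (p ^ i).-1)%N.
  rewrite addnC; case: (p ^ i)%N (expn_gt0 p i) => [|r].
    by rewrite p_gt0.
  by rewrite addnS.
rewrite exprD mulrAC def_v.
set V := _ ^+ m; set N := nsum U; set s := phi_sum g i.
have sumP : N * (\sum_(j < p ^ i.+1) y ^+ j) = nsum P.
  have := sum_cycle Pg; rewrite og => ->.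
  apply: (@pX_inj n); rewrite -natrX -cardP -nsum_mul => [|x].
    rewrite mulrA [nsum P * N]mulrC nsum_mul => [|x Ux]; last first.
      by rewrite nsum_fixed // (fintype.subsetP sUP).
    rewrite -mulrA [nsum P * _]mulrC nsum_mul => [|x gx]; last first.
      rewrite nsum_fixed //; move: x gx; apply/fintype.subsetP.
      by rewrite cycle_subG.
    by rewrite mulrA -natrM mulnC -(TI_cardMg tiU) defP.
  rewrite -defP => /mulsgP[h u gh Uu ->]; rewrite dM.
  transitivity ((d u * N) * (d h * nsum <[g]>%g)); first ring.
  by rewrite !nsum_fixed.
(* [g] fixes [nsum P], so [v] acts on it as [v.[1] = -1]. *)
have VP : V * nsum P = (-1) ^+ m * nsum P.
  have fixP : (map_poly intr v).[y] * nsum P = - nsum P.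
    by rewrite horner_int_fixed ?nsum_fixed // v1 rmorphN mulN1r.
  rewrite /V; elim: (m) => [|k IHk]; first by [].
  by rewrite exprSr -mulrA fixP mulrN IHk exprS; ring.
set E := (y - 1) ^+ _.
(* The exponents in [E] and in [sub1_phi] add up to [(p ^ i.+1).-1], the power given by
   [sub1_pX_pred]. *)
have Es : E * s = \sum_(j < p ^ i.+1) y ^+ j + p%:R * (map_poly intr w).[y]
                 - p%:R * (map_poly intr f).[y] * E.
  rewrite -def_w -[s](addrK (p%:R * (map_poly intr f).[y])) -def_f mulrBr.
  rewrite -exprD; congr (_ ^+ _ - _); last exact: mulrC.
  by have := expn_gt0 p i; rewrite expnS p_gt0 /=; nia.
have LN := Lam_nsum rLam Lam_d U.
have Lh (r : {poly int}) : Lam (map_poly intr r).[y].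
  by apply: subring_horner; rewrite ?/y.
have LV : Lam V by apply: LX.
have LE : Lam E by apply: Lam_sub1.
set F := (map_poly intr f).[y] in Es; set W := (map_poly intr w).[y] in Es.
have -> : V * (N * (1 - ip * s)) * E =
    V * N * (E - W + F * E) - ip * (V * nsum P).
  rewrite -sumP.
  transitivity (V * N * E - ip * V * N * (E * s)); first ring.
  rewrite Es; transitivity (V * N * (E - p%:R * ip * W + p%:R * ip * F * E)
    - ip * (V * (N * \sum_(j < p ^ i.+1) y ^+ j))); first ring.
  by rewrite p_ip !mul1r.
rewrite VP => Lx.
have {Lx} : Lam (ip * ((-1) ^+ m * nsum P)).
  rewrite -[ip * _]opprK -[- (ip * _)](addrK (V * N * (E - W + F * E))).
  apply: subringN => //; apply: LB; first by rewrite addrC.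
  apply: subringM => //; first exact: (subringM rLam).
  apply: subringD => //; first by apply: (subringB rLam); [|apply: Lh].
  by apply: (subringM rLam); [apply: Lh|].
move=> /(subringM rLam (LX _ m (subringN rLam L1))).
by rewrite mulrCA signrMK.
Qed.

End Uniformizers.

End Cells.

(** * p-adic integers and their group rings *)

Section PadicFacts.
Import GRing.Theory.
Local Open Scope ring_scope.
Variables (p : nat) (p_pr : prime p).
Local Notation Zp := (padic_int p_pr).
Local Notation q k := (Posz (p ^ k)%N).
Implicit Types x y : Zp.

Lemma padic_resD x y k : (x + y) k = ((x k + y k) %% q k)%Z.
Proof. by []. Qed.

Lemma padic_resM x y k : (x * y) k = ((x k * y k) %% q k)%Z.
Proof. by []. Qed.

Lemma padic_res0 k : (0 : Zp) k = 0.
Proof. exact: mod0z. Qed.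

Lemma padic_res_nat m k : (m%:R : Zp) k = (m%:Z %% q k)%Z.
Proof.
elim: m => [|m IHm]; first by [].
transitivity (((m%:Z %% q k)%Z + (1 %% q k)%Z) %% q k)%Z.
  by rewrite -[m.+1]addn1 natrD padic_resD IHm.
by rewrite modzDm -addn1 PoszD.
Qed.

Lemma padic_res_pX x k : (x *+ (p ^ k)) k = 0.
Proof. by rewrite -mulr_natl padic_resM padic_res_nat modzz mul0r mod0z. Qed.

(** The residue of [x] at [j + k], divided by [p ^ k], is the residue of [y] at [j]. *)
Lemma padic_res_pXP x k : x k = 0 -> exists y, x = y *+ (p ^ k).
Proof.
move=> xk0; have q_gt0 j : (0 < p ^ j)%N by rewrite expn_gt0 prime_gt0.
have xE j : x (j + k)%N = (x (j + k)%N %/ q k)%Z * q k.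
  rewrite divzK //; apply/dvdz_mod0P; have := padic_modD x k j.
  by rewrite addnC xk0.
have resP j : ((x (j.+1 + k)%N %/ q k)%Z %% q j)%Z = (x (j + k)%N %/ q k)%Z.
  apply: (@mulIf _ (q k)); first by rewrite eqz_nat -lt0n.
  rewrite -xE mulz_modl ?ltz_nat // -xE -PoszM -expnD addSn.
  by rewrite padic_resP.
exists (PadicInt p_pr resP); apply: padicP => j.
rewrite -mulr_natl padic_resM padic_res_nat modzMml mulrC /= -xE.
by rewrite padic_modD.
Qed.

Lemma padic_frobenius x f : exists y, x ^+ (p ^ f) - x = y *+ p.
Proof.
elim: f => [|f [y IHf]]; first by exists 0; rewrite expr1 subrr mul0rn.
have frob (z : Zp) : exists w, z ^+ p - z = w *+ p.
  have [m ez] : exists m, z 1%N = m%:Z.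
    have := padic_mod z 1; rewrite expn1 => <-.
    exists `|(z 1%N %% p)%Z|%N; rewrite gez0_abs // modz_ge0 //.
    by rewrite eqz_nat -lt0n prime_gt0.
  suff zp0 : (z ^+ p - z) 1%N = 0.
    by have [w ->] := padic_res_pXP zp0; exists w; rewrite expn1.
  have expz k : (z ^+ k) 1%N = ((m ^ k)%:Z %% q 1)%Z.
    elim: k => [|k IHk]; first by [].
    by rewrite exprS padic_resM IHk ez modzMmr -PoszM -expnS.
  have -> : (z ^+ p - z) 1%N =
      (((z ^+ p) 1%N + (- z 1%N %% q 1)%Z) %% q 1)%Z by [].
  rewrite expz ez modz_nat expn1 fermat_little // -modz_nat modzDm subrr.
  by rewrite mod0z.
have [w def_w] := frob (x ^+ (p ^ f)).
exists (w + y); rewrite expnSr exprM mulrnDl -def_w -IHf addrA subrK //.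
Qed.

Variables (gT : finGroupType).
Local Notation B := (group_alg Zp gT).

Lemma group_algMnE (R : comNzRingType) (b : group_alg R gT) k g :
  (b *+ k) g = b g *+ k.
Proof. by rewrite ffunMnE. Qed.

(* The inverse is the [p]-adic limit of the geometric series. *)
Lemma group_alg_sub1_inv (b : B) : exists c, (1 - b *+ p) * c = 1.
Proof.
pose S k : B := \sum_(j < k) (b *+ p) ^+ j.
(* Consecutive partial sums differ by [(b *+ p) ^+ k], which vanishes modulo [p ^ k]; so the
   diagonal residues are compatible. *)
have Sres k g : (S k.+1 g) k = (S k g) k.
  rewrite /S big_ord_recr /= ffunE padic_resD exprMn_n group_algMnE padic_res_pX.
  by rewrite addr0 padic_mod.
have cP g k : ((S k.+1 g) k.+1 %% q k)%Z = (S k g) k by rewrite padic_resP Sres.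
pose c : B := [ffun g => PadicInt p_pr (cP g)].
exists c; apply/ffunP => g; apply: padicP => k.
have [e def_e] : exists e : {ffun gT -> Zp},
    forall x : gT, c x - S k x = e x *+ (p ^ k).
  have /fin_all_exists[e def_e] (x : gT) : exists y, c x - S k x = y *+ (p ^ k).
    apply: padic_res_pXP.
    have -> : (c x - S k x) k = ((c x k + (- (S k x) k %% q k)%Z) %% q k)%Z by [].
    by rewrite ffunE /= modzDmr subrr mod0z.
  by exists [ffun x : gT => e x] => x; rewrite def_e [in RHS]ffunE.
have -> : c = S k + (e : B) *+ (p ^ k).
  apply/ffunP => x; rewrite [RHS]ffunE group_algMnE -def_e.
  by rewrite addrC subrK.
have -> : (1 - b *+ p) * (S k + (e : B) *+ (p ^ k)) =
    1 + ((1 - b *+ p) * e - b ^+ k) *+ (p ^ k).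
  rewrite mulrDr mulrnAr mulrnBl addrCA addrC; congr (_ + _).
  by rewrite -[1 - b *+ p]opprB mulNr -subrX1 opprB exprMn_n.
by rewrite ffunE padic_resD group_algMnE padic_res_pX addr0 padic_mod.
Qed.
End PadicFacts.

(** * Frobenius modulo an ideal containing [p] *)

Section FrobeniusModIdeal.
Import GRing.Theory.
Local Open Scope ring_scope.
Local Open Scope classical_set_scope.
Variables (A : comNzRingType) (Lam I : set A) (rLam : is_subring Lam).
Variables (p : nat) (p_pr : prime p).
Hypothesis IB : forall x y, I x -> I y -> I (x - y).
Hypothesis IM : forall x y, Lam x -> I y -> I (x * y).
Hypothesis Ip : I p%:R.

Lemma ideal0 : I 0.
Proof. by rewrite -(subrr p%:R); apply: IB. Qed.

Lemma idealD x y : I x -> I y -> I (x + y).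
Proof.
move=> Ix Iy; rewrite -[y]opprK; apply: IB => //; rewrite -[- y]add0r.
by apply: IB => //; apply: ideal0.
Qed.

Lemma frobeniusD x y : Lam x -> Lam y ->
  I ((x + y) ^+ p - (x ^+ p + y ^+ p)).
Proof.
move=> Lx Ly; have p_gt0 := prime_gt0 p_pr.
have max_neq0 : (ord_max : 'I_p.+1) != ord0 by rewrite -val_eqE /= -lt0n.
rewrite exprDn (bigD1 ord0) //= (bigD1 ord_max) //= subn0 subnn bin0 binn.
rewrite !mulr1n !expr0 mulr1 mul1r [X in X - _]addrA [X in I X]addrAC subrr add0r.
apply: big_ind => [||i /andP[nz_i nmax_i]]; [exact: ideal0|exact: idealD|].
have p_dv : (p %| 'C(p, i))%N.
  rewrite prime_dvd_bin // lt0n nz_i /= ltn_neqAle -ltnS ltn_ord andbT.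
  by apply: contra nmax_i => /eqP eq_ip; apply/eqP/val_inj.
rewrite -(divnK p_dv) mulrnA -[_ *+ p]mulr_natr; apply: IM => //.
rewrite -mulr_natr; apply: (subringM rLam); last exact: subring_nat.
by apply: (subringM rLam); apply: subringX.
Qed.

Lemma ideal_congX x y k : Lam x -> Lam y -> I (x - y) -> I (x ^+ k - y ^+ k).
Proof.
move=> Lx Ly Ixy; rewrite subrXX mulrC; apply: IM => //.
apply: subring_sum => // i _; apply: (subringM rLam); exact: subringX.
Qed.

Lemma frobeniusXD x y f : Lam x -> Lam y ->
  I ((x + y) ^+ (p ^ f) - (x ^+ (p ^ f) + y ^+ (p ^ f))).
Proof.
move=> Lx Ly; elim: f => [|f IHf].
  by rewrite !expr1 subrr; apply: ideal0.
have [Lxf Lyf] : Lam (x ^+ (p ^ f)) /\ Lam (y ^+ (p ^ f)).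
  by split; apply: subringX.
have Lxy : Lam ((x + y) ^+ (p ^ f)) by apply: subringX => //; apply: subringD.
rewrite expnSr !exprM.
set u := x ^+ _ in IHf Lxf *; set v := y ^+ _ in IHf Lyf *.
set w := (x + y) ^+ _ in IHf Lxy *.
have -> : w ^+ p - (u ^+ p + v ^+ p) =
  (w ^+ p - (u + v) ^+ p) + ((u + v) ^+ p - (u ^+ p + v ^+ p)).
  by rewrite addrA subrK.
apply: idealD; last exact: frobeniusD.
by apply: ideal_congX => //; apply: subringD.
Qed.

Lemma frobenius_sum (J : Type) (r : seq J) (F : J -> A) f :
  (forall j, Lam (F j)) -> (forall j, I (F j ^+ (p ^ f) - F j)) ->
  let z := \sum_(j <- r) F j in I (z ^+ (p ^ f) - z).
Proof.
move=> LF IF z; suff [] : Lam z /\ I (z ^+ (p ^ f) - z) by [].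
rewrite /z; elim/big_rec: _ => [|j w _ [Lw Iw]].
  split; first exact: subring0.
  by rewrite expr0n expn_eq0 -leqn0 leqNgt prime_gt0 //= subrr; apply: ideal0.
split; first exact: subringD.
have -> : (F j + w) ^+ (p ^ f) - (F j + w) =
    ((F j + w) ^+ (p ^ f) - (F j ^+ (p ^ f) + w ^+ (p ^ f))) +
    ((F j ^+ (p ^ f) - F j) + (w ^+ (p ^ f) - w)) by ring.
apply: idealD; [exact: frobeniusXD|exact: idealD].
Qed.

End FrobeniusModIdeal.

(** * Frobenius on the group ring and the length of its chain *)

Section GroupRingFrobenius.
Import GRing.Theory.
Local Open Scope ring_scope.
Variables (p : nat) (p_pr : prime p) (gT : finGroupType) (A : comNzRingType).
Variables (Lam : set A) (rLam : is_subring Lam).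
Variables (kappa : padic_int p_pr -> A) (d : gT -> A).
Hypothesis kappa1 : kappa 1 = 1.
Hypothesis kappaB : {morph kappa : x y / x - y}.
Hypothesis kappaM : {morph kappa : x y / x * y}.
Hypothesis d1 : d 1%g = 1.
Hypothesis dM : {morph d : x y / (x * y)%g >-> x * y}.
Hypothesis Lam_kappa : forall c, Lam (kappa c).
Hypothesis Lam_d : forall g, Lam (d g).
Hypothesis Lam_sum : forall z, Lam z -> exists c, z = \sum_g kappa (c g) * d g.

Lemma kappaMn c k : kappa (c *+ k) = kappa c *+ k.
Proof.
have k0 : kappa 0 = 0 by rewrite -(subrr 0) kappaB subrr.
elim: k => [|k IHk]; first by rewrite !mulr0n k0.
have -> : c *+ k.+1 = c - (0 - c *+ k) by rewrite sub0r opprK mulrS.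
by rewrite !kappaB k0 IHk sub0r opprK mulrS.
Qed.

Lemma kappaX c k : kappa (c ^+ k) = kappa c ^+ k.
Proof. by elim: k => [|k IHk]; rewrite ?expr0 // !exprS kappaM IHk. Qed.

(* Modulo [p] and the [x - 1] with [x] in the Sylow subgroup, the group ring is
   spanned by the images of the [p']-elements, all fixed by the [q]-th power
   map. *)
Lemma group_ring_frobenius (P : {group gT}) : abelian [set: gT] ->
  (p.-Sylow([set: gT]) P)%g -> exists2 q, (1 < q)%N &
  forall I : set A, (forall x y, I x -> I y -> I (x - y)) ->
    (forall x y, Lam x -> I y -> I (x * y)) -> I p%:R ->
    (forall x, x \in P -> I (d x - 1)) ->
    forall z, Lam z -> I (z ^+ q - z).
Proof.
move=> abelG sylP; set m := #|[set: gT] : P|%g.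
have co_pm : coprime p m.
  by have [_ _] := and3P sylP; rewrite p'natE // prime_coprime.
have sPG : P \subset [set: gT] by have [] := and3P sylP.
have m_gt0 : (0 < m)%N by apply: indexg_gt0.
have f_gt0 : (0 < totient m)%N by rewrite totient_gt0.
(* By Euler's theorem [m] divides [q - 1], which puts every [g ^+ q.-1] in [P]. This [q] is
   independent of [I] and so serves all components at once. *)
exists (p ^ totient m)%N.
  by rewrite -(expn0 p) ltn_exp2l ?prime_gt1.
set q := (p ^ _)%N; move=> I IB IM Ip Ipt z Lz.
have q_gt0 : (0 < q)%N by rewrite expn_gt0 prime_gt0.
have gP g : (g ^+ q.-1)%g \in P.
  have /dvdnP[r ->] : (m %| q.-1)%N.
    have := Euler_exp_totient co_pm; rewrite -/q => /eqP.
    by rewrite eqn_mod_dvd // subn1.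
  have nsPG : (P <| [set: gT])%g by rewrite -sub_abelian_normal.
  rewrite mulnC expgM groupX // (mem_normal_Hall sylP nsPG) ?inE //.
  apply: pnat_dvd (pHall_pgroup sylP).
  rewrite order_dvdn -expgM mulnC Lagrange //.
  by rewrite -order_dvdn order_dvdG ?inE.
have [c ->] := Lam_sum Lz.
have dXE g j : d g ^+ j = d (g ^+ j)%g.
  by elim: j => [|j IHj]; rewrite ?d1 // exprS expgS dM IHj.
apply: (frobenius_sum rLam p_pr IB IM Ip) => g; first exact: (subringM rLam).
have [w def_w] := padic_frobenius (c g) (totient m).
have Ek : kappa (c g) ^+ q = kappa w * p%:R + kappa (c g).
  by rewrite mulr_natr -kappaMn -def_w kappaB kappaX subrK.
have Ed : d g ^+ q = d g * d (g ^+ q.-1)%g.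
  by rewrite -dM -expgS prednK // dXE.
have -> : (kappa (c g) * d g) ^+ q - kappa (c g) * d g =
    kappa w * d g ^+ q * p%:R + kappa (c g) * d g * (d (g ^+ q.-1)%g - 1).
  by rewrite exprMn Ek Ed; ring.
apply: (idealD IB Ip); apply: IM => //.
- by apply: (subringM rLam) => //; apply: subringX.
- exact: (subringM rLam).
exact: Ipt.
Qed.

(** Instance of [is_lrad_chain]: the components are the atoms, [e] is [p ^ a], and [eps0] and
    [t0 = d g - 1] come from the extremal cell. *)
Theorem group_ring_lrad (P : {group gT}) (n a : nat) (ip : A) :
  abelian [set: gT] -> (p.-Sylow([set: gT]) P)%g ->
  #|P| = (p ^ n)%N -> exponent P = (p ^ a)%N -> (0 < a)%N ->
  p%:R * ip = 1 ->
  (forall b, Lam b -> exists2 b', Lam b' & (1 - p%:R * b) * b' = 1) ->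
  ~ Lam (ip * nsum d P) ->
  is_lrad Lam (p ^ (a - 1) + (p ^ a - p ^ (a - 1)) * (n - a))%N.
Proof.
move=> abelG sylP cardP expP a_gt0 p_ip Lam_inv nLam.
have abelP : abelian P by apply: abelianS abelG.
have pgrpP : (p.-group P)%g := pHall_pgroup sylP.
set c := (p ^ (a - 1) + _)%N.
have [q q_gt1 frob] := group_ring_frobenius abelG sylP.
have /fin_all_exists[t tP] := atom_uniformizer p_pr d1 dM p_ip pgrpP abelP rLam
  cardP expP a_gt0 Lam_d.
have [g [eps0 [Pg eps0_max neps0]]] := extremal_cell p_pr d1 dM p_ip pgrpP abelP
  rLam cardP expP a_gt0 Lam_d.
have LM := subringM rLam; have LB := subringB rLam.
apply: (@is_lrad_chain A Lam rLam p q n (p ^ a) c {set gT} (atom d p ip P) t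
  eps0 (d g - 1)) => //.
- by move=> x px0; rewrite -[x]mul1r -p_ip mulrAC px0 mul0r.
- move=> S z Lz; have [[_ p_t sub1_t] _] := tP S.
  (* The elements that act on the atom as multiples of [t S]: closed under differences and under
     [Lam], and containing [p] and each [d x - 1] with [x] in [P]. *)
  pose I := [set x | exists2 b, Lam b &
    x * atom d p ip P S = t S * b * atom d p ip P S]%classic.
  apply: (frob I) => // [x y [b Lb bE] [e Le eE]|x y Lx [b Lb bE]].
    by exists (b - e); [apply: LB|rewrite mulrBl bE eE; ring].
  exists (x * b); first exact: LM.
  by rewrite -mulrA bE; ring.
- exact: sum_atom.
- by move=> S; have [[]] := tP S.
- by move=> S; have [[]] := tP S.
- by move=> S; have [_ []] := tP S.
- by move=> S; have [_ []] := tP S.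
- by move=> S; have [_ []] := tP S.
- by rewrite /c addn_gt0 expn_gt0 prime_gt0.
- by apply: LB => //; apply: (subring1 rLam).
- by move=> S; have [[_ _ +] _] := tP S; apply.
by move/neps0.
Qed.

End GroupRingFrobenius.

(** * Commutativity and group elements in the convolution algebra *)

Section GroupAlgebraPoints.
Import GRing.Theory.
Local Open Scope ring_scope.
Variables (R : comNzRingType) (gT : finGroupType).
Local Notation B := (group_alg R gT).

Lemma group_alg_mulC : abelian [set: gT] -> commutative (@GRing.mul B).
Proof.
move=> abelG f h; apply/ffunP => x; rewrite !ffunE.
rewrite (reindex_inj invg_inj) (reindex_inj (mulIg x^-1)%g) /=.
apply: eq_bigr => y _; rewrite mulrC; congr (h _ * f _).
  by rewrite invgK mulgKV.
by rewrite invMg invgK (centsP abelG) ?inE.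
Qed.

Definition group_pt (g : gT) : B := [ffun x => (x == g)%:R].

Lemma group_ptM : {morph group_pt : g h / (g * h)%g >-> g * h}.
Proof.
move=> g h; apply/ffunP => x; rewrite !ffunE (bigD1 g) //= big1 => [|y ny].
  by rewrite !ffunE eqxx mul1r addr0 -(inj_eq (mulgI g^-1)%g) mulKg.
by rewrite ffunE (negPf ny) mul0r.
Qed.

Lemma group_alg_sumE (f : B) : f = \sum_g f g *: group_pt g.
Proof.
apply/ffunP => x; rewrite sum_ffunE (bigD1 x) //= big1 => [|y ny].
  by rewrite !ffunE eqxx addr0; apply/esym/mulr1.
by rewrite !ffunE eq_sym (negPf ny); apply: mulr0.
Qed.

End GroupAlgebraPoints.

(** * The p-adic group ring inside the rational one *)

Section PadicGroupRing.
Import GRing.Theory.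
Local Open Scope ring_scope.
Variables (p : nat) (p_pr : prime p) (gT : finGroupType).
Local Notation Zp := (padic_int p_pr).
Local Notation K := (padic_field p_pr).
Local Notation B := (group_alg Zp gT).
Local Notation A := (group_alg K gT).
Local Notation Lam := (padic_group_ring p_pr gT).
Local Notation pt := (@group_pt K gT).

Definition group_alg_frac (b : B) : A := [ffun x => FracField.tofrac (b x)].
Local Notation iota := group_alg_frac.

Lemma padic_group_ringP (f : A) : Lam f <-> exists b, f = iota b.
Proof.
split=> [/fin_all_exists[b def_f]|[b ->] x]; last by exists (b x); rewrite ffunE.
by exists [ffun x => b x]; apply/ffunP => x; rewrite !ffunE.
Qed.

Lemma group_alg_frac1 : iota 1 = 1.
Proof.
by apply/ffunP => x; rewrite !ffunE; case: eqP; rewrite ?tofrac1 ?tofrac0.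
Qed.

Lemma group_alg_fracB b c : iota (b - c) = iota b - iota c.
Proof. by apply/ffunP => x; rewrite !ffunE tofracB. Qed.

Lemma group_alg_fracM b c : iota (b * c) = iota b * iota c.
Proof.
apply/ffunP => x; rewrite !ffunE rmorph_sum /=; apply: eq_bigr => y _.
by rewrite tofracM !ffunE.
Qed.

Lemma group_alg_fracMn b k : iota (b *+ k) = iota b *+ k.
Proof. by apply/ffunP => x; rewrite ffunE !group_algMnE tofracMn ffunE. Qed.

Lemma padic_field_p_neq0 : p%:R != 0 :> K.
Proof.
rewrite -(rmorph_nat (@FracField.tofrac Zp)) tofrac_eq0; apply/eqP.
(* Index 2 is the first at which [p] has a nonzero residue. *)
move/(congr1 (fun x : Zp => x 2)); rewrite padic_res_nat padic_res0 modz_small.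
  by move/eqP; rewrite eqz_nat -leqn0 leqNgt prime_gt0.
by rewrite /= ltz_nat -{1}(expn1 p) ltn_exp2l ?prime_gt1.
Qed.

Definition inv_p : A := (p%:R^-1 : K) *: 1.

Lemma p_inv_p : p%:R * inv_p = 1.
Proof.
rewrite mulr_natl /inv_p scalerMnl -[_ *+ p]mulr_natr mulVf ?scale1r //.
exact: padic_field_p_neq0.
Qed.

(** The coefficient at the identity is the inverse of [p], which is no p-adic integer, as residues
    modulo [p] show. *)
Lemma inv_pM_notin (f : A) : f 1%g = 1 -> ~ Lam (inv_p * f).
Proof.
rewrite /inv_p -scalerAl mul1r => f1 /(_ 1%g)[z]; rewrite ffunE f1.
move=> def_z; have {def_z} : FracField.tofrac (z *+ p) = 1.
  rewrite tofracMn -def_z -[LHS]mulr_natl [RHS](_ : _ = p%:R * p%:R^-1).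
    by congr (_ * _); apply: mulr1.
  by rewrite mulfV // padic_field_p_neq0.
move/eqP; rewrite -tofrac1 tofrac_eq => /eqP zp1.
have := padic_res_pX z 1; rewrite expn1 zp1 -(mulr1n 1) padic_res_nat expn1.
by rewrite modz_small //= ltz_nat prime_gt1.
Qed.

Hypothesis abelG : abelian [set: gT].

(** Commutativity depends on [abelG], so the structure is packed under a name; the [com_] lemmas
    restate facts for it. *)
Definition com_group_alg : comNzRingType := HB.pack A
  (GRing.PzRing_hasCommutativeMul.Build A (group_alg_mulC abelG)).
Local Notation cA := com_group_alg.

Lemma padic_group_ring_subring : @is_subring cA Lam.
Proof.
split=> [|f h /padic_group_ringP[b ->] /padic_group_ringP[c ->]
         |f h /padic_group_ringP[b ->] /padic_group_ringP[c ->]];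
  apply/padic_group_ringP.
- by exists 1; rewrite group_alg_frac1.
- by exists (b - c); rewrite group_alg_fracB.
by exists (b * c); rewrite group_alg_fracM.
Qed.

Lemma padic_group_ring_pt g : Lam (pt g).
Proof. by move=> x; exists (x == g)%:R; rewrite ffunE rmorph_nat. Qed.

Lemma padic_group_ring_inv (b : cA) : Lam b ->
  exists2 b', Lam b' & (1 - p%:R * b) * b' = 1.
Proof.
case/padic_group_ringP => b0 ->; have [c0 def_c] := group_alg_sub1_inv b0.
exists (iota c0); first by apply/padic_group_ringP; exists c0.
rewrite mulr_natl -[1 in RHS]group_alg_frac1 -def_c group_alg_fracM.
by rewrite group_alg_fracB group_alg_frac1 group_alg_fracMn.
Qed.


Definition padic_scalar (c : Zp) : A := FracField.tofrac c *: 1.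

Lemma padic_scalarB : {morph padic_scalar : x y / x - y}.
Proof. by move=> x y; rewrite /padic_scalar tofracB scalerBl. Qed.

Lemma padic_scalarM : {morph padic_scalar : x y / x * y}.
Proof.
by move=> x y; rewrite /padic_scalar tofracM -scalerAl mul1r scalerA.
Qed.

Lemma padic_group_ring_scalar c : Lam (padic_scalar c).
Proof.
move=> x; exists (c * (x == 1%g)%:R); rewrite !ffunE tofracM rmorph_nat.
by [].
Qed.

Lemma padic_group_ring_sum z : Lam z ->
  exists c : gT -> Zp, z = \sum_g padic_scalar (c g) * pt g.
Proof.
case/fin_all_exists=> c def_z; exists c; rewrite [LHS]group_alg_sumE.
by apply: eq_bigr => g _; rewrite def_z -scalerAl mul1r.
Qed.

Lemma com_padic_scalarM : {morph (padic_scalar : Zp -> cA) : x y / x * y}.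
Proof. exact: padic_scalarM. Qed.

Lemma com_group_ptM : {morph (pt : gT -> cA) : x y / (x * y)%g >-> x * y}.
Proof. exact: group_ptM. Qed.

Lemma com_p_inv_p : p%:R * (inv_p : cA) = 1.
Proof. exact: p_inv_p. Qed.

Lemma com_inv_p_nsum (P : {group gT}) :
  ~ Lam ((inv_p : cA) * nsum (pt : gT -> cA) P).
Proof.
apply: (@inv_pM_notin (\sum_(x in P) pt x)).
rewrite sum_ffunE (bigD1 1%g) //= big1 => [|x /andP[_ nx]].
  by rewrite ffunE eqxx addr0.
by rewrite ffunE eq_sym (negPf nx).
Qed.

End PadicGroupRing.

Theorem theorem8p4 (p : nat) (p_pr : prime p) (gT : finGroupType)
    (P : {group gT}) (n a : nat)
    (abelG : abelian [set: gT]) (sylP : (p.-Sylow([set: gT]) P)%g)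
    (cardP : #|P| = (p ^ n)%N) (expP : exponent P = (p ^ a)%N)
    (exp_gt1 : (1 < p ^ a)%N) :
  is_lrad (padic_group_ring p_pr gT)
    (p ^ (a - 1) + (p ^ a - p ^ (a - 1)) * (n - a))%N.
Proof.
have a_gt0 : (0 < a)%N by case: a exp_gt1 {expP}.
have rLam := padic_group_ring_subring p_pr abelG.
apply: (@group_ring_lrad p p_pr gT (com_group_alg p_pr abelG) _ rLam
  (@padic_scalar p p_pr gT) (@group_pt (padic_field p_pr) gT) _ _ _ _ _ _ _ _
  P n a (@inv_p p p_pr gT)) => //.
- by rewrite /padic_scalar tofrac1 GRing.scale1r.
- exact: padic_scalarB.
- exact: com_padic_scalarM.
- exact: com_group_ptM.
- exact: padic_group_ring_scalar.
- exact: padic_group_ring_pt.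
- exact: padic_group_ring_sum.
- exact: com_p_inv_p.
- exact: padic_group_ring_inv.
exact: com_inv_p_nsum.
Qed.
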